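(* For any positive integers $t,s$ with $ts=n$, there is an $[nt,s]$-scheme for \textsc{MaxMatching} on $n$-vertex graphs. This is optimal up to logarithmic factors, since any $(h,v)$-scheme for \textsc{MaxMatching} requires $hv=\Omega(n^2)$.
   Context: Annotated streaming model (schemes): a space-bounded Verifier reads an input stream $\sigma$; after the stream ends, an all-powerful Prover sends a help message to the Verifier as a stream. A scheme for a function $f$ consists of the Verifier's randomized streaming algorithm, the honest Prover's help function, and the Verifier's output procedure, outputting a value in $\mathrm{range}(f)\cup\{\bot\}$ ($\bot$ = reject), with perfect completeness (honest help makes the Verifier output $f(\sigma)$ with probability 1) and soundness error at most $1/3$ (for every $\sigma$ and every help message, the probability of outputting a value outside $\{f(\sigma),\bot\}$ is at most $1/3$). An $(h,v)$-scheme uses $O(h)$ bits of help and $O(v)$ bits of space; an $[h,v]$-scheme uses $\tilde{O}(h)$ bits of help and $\tilde{O}(v)$ bits of space, where $\tilde{O}$ hides factors polynomial in $\log n$. \textsc{MaxMatching}: the input is a graph $G$ on vertex set $[n]$ given as a stream of its edges; the desired output is $\alpha'(G)$, the cardinality of a maximum matching of $G$. *)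

(* Defs.v *)
From HB Require Import structures.
From mathcomp Require Import all_boot all_order all_algebra.
From mathcomp Require Import reals.
Set Implicit Arguments.
Unset Strict Implicit.
Unset Printing Implicit Defensive.
Import Order.TTheory GRing.Theory Num.Theory.
Local Open Scope ring_scope.

(** Graphs on vertex set [n] = 'I_n.  An (undirected) edge is a 2-element
    subset of 'I_n.  The input stream is a sequence of stream items
    (elements of {set 'I_n}); a valid stream lists the edges of a simple
    graph, each edge exactly once, in arbitrary order. *)
Definition valid_stream (n : nat) (sigma : seq {set 'I_n}) : bool :=
  uniq sigma && seq.all (fun e : {set 'I_n} => #|e| == 2%N) sigma.

Definition graph_of (n : nat) (sigma : seq {set 'I_n}) : {set {set 'I_n}} :=
  [set e | e \in sigma].

Definition is_matching (n : nat) (E M : {set {set 'I_n}}) : bool :=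
  (M \subset E) &&
  [forall e in M, forall e' in M, (e != e') ==> [disjoint e & e']].

Definition matching_number (n : nat) (E : {set {set 'I_n}}) : nat :=
  \max_(M : {set {set 'I_n}} | is_matching E M) #|M|.

Definition MaxMatching (n : nat) (sigma : seq {set 'I_n}) : nat :=
  matching_number (graph_of sigma).

(** A Verifier with [vspace] bits of memory: a probabilistic automaton
    whose states are 'I_(2 ^ vspace) (all bit-strings of length vspace).
    It starts in a random state (distribution [vinit]), processes each
    stream item and then each help bit by a randomized transition, and
    finally outputs [Some k] (the value k) or [None] (reject, i.e. bot). *)
Record verifier (R : realType) (n : nat) := Verifier {
  vspace : nat;
  vinit : {ffun 'I_(2 ^ vspace) -> R};
  vstep : {set 'I_n} -> 'I_(2 ^ vspace) -> {ffun 'I_(2 ^ vspace) -> R};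
  vread : bool -> 'I_(2 ^ vspace) -> {ffun 'I_(2 ^ vspace) -> R};
  vout : 'I_(2 ^ vspace) -> option nat }.

Arguments vspace {R n} v.
Arguments vinit {R n} v.
Arguments vstep {R n} v _ _.
Arguments vread {R n} v _ _.
Arguments vout {R n} v _.

Definition is_dist (R : realType) (S : finType) (d : {ffun S -> R}) : Prop :=
  (forall x, 0 <= d x) /\ \sum_x d x = 1.

Definition wf_verifier (R : realType) (n : nat) (V : verifier R n) : Prop :=
  is_dist (vinit V) /\
  (forall e x, is_dist (vstep V e x)) /\
  (forall b x, is_dist (vread V b x)).

Definition push (R : realType) (S : finType) (d : {ffun S -> R})
  (K : S -> {ffun S -> R}) : {ffun S -> R} :=
  [ffun y => \sum_x d x * K x y].

Definition run (R : realType) (n : nat) (V : verifier R n)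
  (sigma : seq {set 'I_n}) (w : seq bool) : {ffun 'I_(2 ^ vspace V) -> R} :=
  foldl (fun d b => push d (vread V b))
        (foldl (fun d e => push d (vstep V e)) (vinit V) sigma) w.

Definition prob_out (R : realType) (n : nat) (V : verifier R n)
  (sigma : seq {set 'I_n}) (w : seq bool) (P : pred (option nat)) : R :=
  \sum_(x | P (vout V x)) run V sigma w x.

Definition is_scheme (R : realType) (n : nat)
  (f : seq {set 'I_n} -> nat) (V : verifier R n)
  (prover : seq {set 'I_n} -> seq bool) (hb : nat) : Prop :=
  wf_verifier V /\
  (forall sigma, valid_stream sigma -> (size (prover sigma) <= hb)%N) /\
  (forall sigma, valid_stream sigma ->
     prob_out V sigma (prover sigma) (pred1 (Some (f sigma))) = 1) /\
  (forall sigma (w : seq bool), valid_stream sigma ->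
     prob_out V sigma w
       (fun o => (o != Some (f sigma)) && (o != None)) <= 3^-1).

Definition logf (n : nat) : nat := (trunc_log 2 n).+1.

(* Main.v *)
Require Import Defs.
From HB Require Import structures.
From mathcomp Require Import all_boot all_order all_algebra all_fingroup.
From mathcomp Require Import reals.
From mathcomp Require Import ring lra zify.
Set Implicit Arguments.
Unset Strict Implicit.
Unset Printing Implicit Defensive.

(** Upper bound.  By the Tutte-Berge formula, alpha'(G) is certified by a matching
    together with a vertex set U and disjoint blocks such that every edge meets U or
    lies in a block, the size of the matching being |U| plus the sum of the
    floor(|block| / 2).  The Prover lists the pairs of the matching, the blocks and U.
    Up to a factor 2, the number of pairs that are edges plus the number of edges that
    are covered is the inner product of the adjacency matrix with a sum of rank-one
    matrices, one for each block; it is a coefficient of a polynomial of degree less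
    than 2nt over F_p, which the Prover also sends.  The Verifier checks it at a random
    point r, keeping s field elements for the graph, for the current block and for the
    sum over the closed blocks.  That each vertex is listed exactly once is checked
    with a fingerprint at the same point r.

    Lower bound.  INDEX on (n/4)^2 bits reduces to MaxMatching: Alice inserts the bits
    as edges of a bipartite graph, Bob hangs a pendant edge on every vertex but the two
    of his index.  A state of positive probability rejects no honest proof, so by
    averaging one can choose h + 2 states, depending on Alice's bits only, for which
    all but half of the indices have no help string convincing all of these states of
    the wrong bit.  These states then determine half of the bits. *)

(** * A prime between X and X^2 *)

(** Bounds by 1 each term of Legendre's formula for the exponent of a prime in a central binomial
    coefficient. *)
Lemma leq_double_divn (k d : nat) : (0 < d)%N -> ((k.*2 %/ d) <= (k %/ d).*2 + 1)%N.
Proof. move=> d_gt0; rewrite -!muln2; nia. Qed.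

(** By Legendre's formula the exponent of [p] is the sum over i of floor(2k/p^i) - 2 floor(k/p^i).
    Each term is at most 1 and those with p^i > 2k vanish, so the exponent is at most
    [trunc_log p k.*2]. *)
Lemma central_bin_pfactor_leq (k p : nat) : (0 < k)%N -> prime p ->
  p ^ logn p 'C(k.*2, k) <= k.*2.
Proof.
move=> k_gt0 p_pr; have p_gt1 := prime_gt1 p_pr.
have k2_gt0 : 0 < k.*2 by rewrite double_gt0.
apply: leq_trans (trunc_logP p_gt1 k2_gt0); rewrite leq_exp2l //.
set L := trunc_log p k.*2.
have kk : k.*2 - k = k by rewrite -addnn addnK.
have binE : 'C(k.*2, k) * (k`! * k`!) = (k.*2)`!.
  by have := @bin_fact k.*2 k; rewrite kk -addnn leq_addr; apply.
have logE : logn p 'C(k.*2, k) + (logn p k`!).*2 = logn p (k.*2)`!.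
  rewrite -binE !lognM ?muln_gt0 ?fact_gt0 ?bin_gt0 ?addnn //.
  by rewrite -addnn leq_addr.
rewrite -(leq_add2r (logn p k`!).*2) logE !logn_fact //.
have Lk : L.+1 <= (k.*2).+1.
  rewrite ltnS -(leq_exp2l _ _ p_gt1).
  by rewrite (leq_trans (trunc_logP p_gt1 k2_gt0)) // ltnW // ltn_expl.
rewrite (@big_cat_nat _ _ _ L.+1) //=.
rewrite [X in _ + X <= _]big_nat_cond [X in _ + X <= _]big1 ?addn0; last first.
  move=> i /andP[/andP[Li _] _]; apply: divn_small.
  by rewrite (leq_trans (trunc_log_ltn _ p_gt1)) // leq_exp2l.
apply: (@leq_trans (\sum_(1 <= i < L.+1) (1 + (k %/ p ^ i).*2))).
  apply: leq_sum => i _; rewrite addnC leq_double_divn // expn_gt0; lia.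
rewrite big_split /= sum_nat_const_nat subn1 /= muln1 leq_add2l.
have -> : \sum_(1 <= i < L.+1) (k %/ p ^ i).*2 = (\sum_(1 <= i < L.+1) (k %/ p ^ i)).*2.
  by rewrite -muln2 big_distrl /=; apply: eq_bigr => i _; rewrite muln2.
(* Legendre's sum for k! stops at k and not at [L]: if L <= k it only has more terms, otherwise the
   terms it lacks vanish. *)
rewrite leq_double; have [le|lt] := leqP L k.
  rewrite [X in _ <= X](@big_cat_nat _ _ _ L.+1) //= leq_addr //.
rewrite (@big_cat_nat _ _ _ k.+1 1 L.+1) //=; last by lia.
rewrite [X in _ + X <= _]big_nat_cond [X in _ + X <= _]big1 ?addn0 //.
move=> i /andP[/andP[Li _] _]; apply: divn_small.
by rewrite (leq_trans Li) // ltnW // ltn_expl.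
Qed.

Lemma exp2_leq_central_bin (k : nat) : 2 ^ k <= 'C(k.*2, k).
Proof.
elim: k => // k IHk.
have h : 'C(k.*2.+2, k.+1) = 'C(k.*2.+1, k.+1).*2.
  rewrite binS -[RHS]addnn; congr (_ + _).
  rewrite -[RHS]bin_sub; last by rewrite ltnS -addnn leq_addr.
  by congr ('C(_, _)); lia.
rewrite doubleS h expnS mul2n leq_double (leq_trans IHk) // binS leq_addl //.
Qed.

(* Otherwise every prime divisor of the central binomial coefficient of 2^(2m) is at
   most 2^m and contributes at most 2^(2m) to it, which makes it too small. *)
Lemma exists_prime_between (m : nat) : 5 <= m ->
  exists2 p, prime p & 2 ^ m < p <= 2 ^ m.*2.
Proof.
move=> m5; set N := 2 ^ m.*2.
have [/hasP[p pN /andP[pp mp]]|/hasPn noP] :=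
  boolP (has (fun p => prime p && (2 ^ m < p)) (iota 0 N.+1)).
  by exists p; rewrite // mp; move: pN; rewrite mem_iota add0n ltnS.
exfalso.
set k := 2 ^ m.*2.-1.
have kN : k.*2 = N by rewrite -mul2n -expnS prednK //; lia.
have k_gt0 : 0 < k by rewrite expn_gt0.
set B := 'C(k.*2, k).
have B_gt0 : 0 < B by rewrite bin_gt0 -addnn leq_addr.
have BN : B <= N ^ (2 ^ m).
  rewrite [X in X <= _](prod_prime_decomp B_gt0) prime_decompE big_map /=.
  apply: (@leq_trans (\prod_(p <- primes B) N)).
    rewrite big_seq_cond [X in _ <= X]big_seq_cond.
    apply: leq_prod => p; rewrite andbT mem_primes => /and3P[pp _ _].
    by rewrite -kN central_bin_pfactor_leq.
  rewrite big_const_seq count_predT iter_muln_1 leq_exp2l; last first.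
    by rewrite -[1]/(2 ^ 0) ltn_exp2l //; lia.
  have sub : {subset primes B <= iota 1 (2 ^ m)}.
    move=> p; rewrite mem_primes => /and3P[pp _ pB].
    rewrite mem_iota add1n ltnS prime_gt0 //=.
    have pN : p <= N.
      rewrite -kN (leq_trans _ (central_bin_pfactor_leq k_gt0 pp)) //.
      by rewrite -{1}[p]expn1 leq_exp2l ?prime_gt1 // -/B logn_gt0 mem_primes pp B_gt0.
    have := noP p; rewrite mem_iota add0n ltnS pN pp /= => /(_ isT).
    by rewrite -leqNgt.
  by rewrite -[X in _ <= X](size_iota 1) uniq_leq_size ?primes_uniq.
have := leq_trans (exp2_leq_central_bin k) BN.
rewrite /N -expnM leq_exp2l // => kk.
(* Comparing exponents gives 2^(2m-1) <= 2m 2^m, that is 2^m <= 4m, which is false from m = 5 on (at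
   m = 4 it is an equality). *)
have : 2 ^ m <= 4 * m.
  have : 2 ^ m * 2 ^ m <= 4 * m * 2 ^ m.
    rewrite -expnD addnn -/N -kN -muln2; move: kk; rewrite -muln2; lia.
  by rewrite leq_mul2r expn_eq0.
apply/negP; rewrite -ltnNge {kk BN noP B_gt0 k_gt0 kN B k N}.
elim: m m5 => // m IH; rewrite leq_eqVlt => /orP[/eqP <- //|]; rewrite ltnS => m5.
by have := IH m5; rewrite expnS; lia.
Qed.

(** * The Tutte-Berge formula *)

Lemma involution_partition (T : finType) (m : T -> T) (S : {set T}) :
  involutive m -> {in S, forall u, m u \in S} ->
  partition [set [set u; m u] | u in S] S.
Proof.
move=> mK mS; apply/and3P; split.
- rewrite eqEsubset; apply/andP; split; apply/subsetP => x.
    case/bigcupP => B /imsetP[u uS ->]; rewrite !inE => /orP[]/eqP->//.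
    exact: mS.
  move=> xS; apply/bigcupP; exists [set x; m x]; first exact: imset_f.
  by rewrite !inE eqxx.
- apply/trivIsetP => A B /imsetP[u uS ->] /imsetP[v vS ->].
  apply: contraNT => /pred0Pn[x /andP[]].
  rewrite !inE => /orP[]/eqP-> /orP[]/eqP h.
  + by rewrite h.
  + by rewrite h mK setUC.
  + by rewrite -h mK setUC.
  + by rewrite (can_inj mK h).
- apply/imsetP => -[u _ /setP/(_ u)]; by rewrite !inE eqxx.
Qed.

Lemma card_involution_pairs (T : finType) (m : T -> T) (S : {set T}) :
  involutive m -> {in S, forall u, m u \in S} -> {in S, forall u, m u != u} ->
  #|S| = #|[set [set u; m u] | u in S]| * 2.
Proof.
move=> mK mS mN; apply: card_uniform_partition (involution_partition mK mS).
by move=> _ /imsetP[u uS ->]; rewrite cards2 eq_sym mN.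
Qed.

(** * Orbits under the product of two involutions *)

Section DihedralOrbit.
Variables (T : finType) (M N : {perm T}) (v : T).
Hypotheses (MK : involutive M) (NK : involutive N) (Nv : N v = v).
Local Open Scope group_scope.
Let f := M * N.

Let MM : M^-1 = M.
Proof. by apply/permP => x; rewrite -{1}[x]MK permK. Qed.

Let NN : N^-1 = N.
Proof. by apply/permP => x; rewrite -{1}[x]NK permK. Qed.

Let N1 : N * N = 1. Proof. by rewrite -{1}NN mulVg. Qed.

Let M1 : M * M = 1. Proof. by rewrite -{1}MM mulVg. Qed.

Let fV : f^-1 = N * M. Proof. by rewrite invMg MM NN. Qed.

Let fN : f ^ N = f^-1.
Proof. by rewrite conjgE NN fV /f -!mulgA N1 mulg1. Qed.

Let fM : f ^ M = f^-1.
Proof. by rewrite conjgE MM fV /f !mulgA M1 mul1g. Qed.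

(** Conjugation by [N] inverts [f] and [N] fixes [v], so [N] reflects the orbit of [v] about [v]. *)
Lemma dihedral_orbitN k : N ((f ^+ k) v) = (f ^- k) v.
Proof. by rewrite -permM conjgC permM Nv conjXg fN expgVn. Qed.

(** Also [M] inverts [f], but it sends [v] to f^-1 v because [N v = v]; hence the shift by one in
    the exponent. *)
Lemma dihedral_orbitM k : M ((f ^+ k) v) = (f ^- k.+1) v.
Proof.
rewrite -permM conjgC permM conjXg fM expgVn expgSr invMg permM.
by rewrite fV permM Nv.
Qed.

(* An M-fixed point f^a v satisfies f^(2a+1) v = v; for two such exponents,
   f^(a-b) v = v because a - b = (2b+1)(a-b) - b(2a-2b). *)
Lemma dihedral_orbit_fixed u w : u \in porbit f v -> w \in porbit f v ->
  M u = u -> M w = w -> u = w.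
Proof.
have stab a : M ((f ^+ a) v) = (f ^+ a) v -> (f ^+ (a.*2.+1)) v = v.
  rewrite dihedral_orbitM => h.
  by rewrite -addnn -addSn addnC expgD permM -h -permM mulVg perm1.
have stabX (g : {perm T}) j : g v = v -> (g ^+ j) v = v.
  move=> gv; elim: j => [|j IHj]; first by rewrite expg0 perm1.
  by rewrite expgS permM gv.
have main a b : (b <= a)%N -> (f ^+ (a.*2.+1)) v = v -> (f ^+ (b.*2.+1)) v = v ->
    (f ^+ a) v = (f ^+ b) v.
  move=> ba ha hb.
  have h2 : (f ^+ ((a - b).*2)) v = v.
    have -> : (f ^+ ((a - b).*2)) v = (f ^+ ((a - b).*2)) ((f ^+ (b.*2.+1)) v) by rewrite hb.
    by rewrite -permM -expgD addSn -doubleD subnKC.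
  have h1 : (f ^+ (a - b)) v = v.
    have := stabX _ (a - b)%N hb; rewrite -expgM.
    have -> : (b.*2.+1 * (a - b) = (a - b).*2 * b + (a - b))%N by lia.
    by rewrite expgD permM expgM (stabX _ b h2).
  have -> : f ^+ a = (f ^+ (a - b) * f ^+ b)%g by rewrite -expgD subnK.
  by rewrite permM h1.
move=> /porbitP[a ->] /porbitP[b ->] /stab ha /stab hb.
by case/orP: (leq_total a b) => h; [symmetry|]; apply: main.
Qed.

Lemma dihedral_orbit_stable u : u \in porbit f v ->
  (M u \in porbit f v) && (N u \in porbit f v).
Proof.
move=> /porbitP[k ->]; rewrite dihedral_orbitM dihedral_orbitN.
have memV j : (f ^- j) v \in porbit f v by rewrite -expgVn -porbitV mem_porbit.
by rewrite !memV.
Qed.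
End DihedralOrbit.

Section TutteBerge.
Variables (T : finType) (e : rel T).
Hypotheses (e_sym : symmetric e) (e_irr : irreflexive e).

(** A matching is coded as an involution: [m u] is the partner of [u], and the missed vertices are
    the fixed points. Two matchings then generate a dihedral action, and [matched] has twice the
    size of the matching. *)
Definition matching_in (W : {set T}) (m : {ffun T -> T}) : bool :=
  [forall u, m (m u) == u] && [forall u, (m u != u) ==> e u (m u) && (u \in W)].

Definition matched (m : {ffun T -> T}) : {set T} := [set u | m u != u].

Lemma matching_inP (W : {set T}) (m : {ffun T -> T}) :
  reflect (involutive m /\ forall u, m u != u -> e u (m u) /\ u \in W) (matching_in W m).
Proof.
apply: (iffP andP) => [[/forallP h1 /forallP h2]|[h1 h2]]; split.
- by move=> u; apply/eqP.
- by move=> u mu; have /implyP/(_ mu)/andP := h2 u.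
- by apply/forallP => u; apply/eqP.
- by apply/forallP => u; apply/implyP => /h2[-> ->].
Qed.

Definition max_matching_in (W : {set T}) (m : {ffun T -> T}) : Prop :=
  matching_in W m /\ forall m', matching_in W m' -> #|matched m'| <= #|matched m|.

Lemma idfun_matching W : matching_in W [ffun u => u].
Proof.
apply/matching_inP; split=> [u|u]; first by rewrite !ffunE.
by rewrite ffunE eqxx.
Qed.

Lemma max_matching_exists W : exists m, max_matching_in W m.
Proof.
have [m mW mmax] := @arg_maxnP _ _ (matching_in W) (fun m => #|matched m|) (idfun_matching W).
by exists m; split.
Qed.

(* Exchanging M and N on the dihedral orbit of v preserves maximality: neither M
   nor N can gain vertices there. *)
Lemma missing_trans (W : {set T}) (u v w : T) (M N : {ffun T -> T}) :
  max_matching_in W M -> max_matching_in W N ->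
  M u = u -> M w = w -> u != w -> N v = v ->
  exists m, max_matching_in W m /\ m v = v /\ (m u = u \/ m w = w).
Proof.
move=> [/matching_inP[MK ME] Mmax] [/matching_inP[NK NE] Nmax] Mu Mw uw Nv.
pose pM := perm (can_inj MK); pose pN := perm (can_inj NK).
have pME x : pM x = M x by rewrite permE.
have pNE x : pN x = N x by rewrite permE.
have pMK : involutive pM by move=> x; rewrite !pME MK.
have pNK : involutive pN by move=> x; rewrite !pNE NK.
have pNv : pN v = v by rewrite pNE.
pose P := porbit (pM * pN)%g v.
have Pst x : x \in P -> (M x \in P) && (N x \in P).
  by move=> /(dihedral_orbit_stable pMK pNK pNv); rewrite pME pNE.
have PM x : (M x \in P) = (x \in P).
  by apply/idP/idP => /Pst/andP[] //; rewrite MK.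
have PN x : (N x \in P) = (x \in P).
  by apply/idP/idP => /Pst/andP[] //; rewrite NK.
pose sw (A B : {ffun T -> T}) := [ffun x => if x \in P then A x else B x].
have swm (A B : {ffun T -> T}) : involutive A -> involutive B ->
   (forall x, (A x \in P) = (x \in P)) -> (forall x, (B x \in P) = (x \in P)) ->
   (forall x, A x != x -> e x (A x) /\ x \in W) ->
   (forall x, B x != x -> e x (B x) /\ x \in W) -> matching_in W (sw A B).
  move=> AK BK PA PB AE BE; apply/matching_inP; split=> x; rewrite !ffunE.
    by case xP: (x \in P); rewrite ?PA ?PB xP ?AK ?BK.
  by case: ifP => _; [apply: AE|apply: BE].
have cardsw (A B : {ffun T -> T}) :
    #|matched (sw A B)| = #|matched A :&: P| + #|matched B :\: P|.
  rewrite -(cardsID P); congr (_ + _); apply: eq_card => x; rewrite !inE ffunE.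
    by case: (x \in P); rewrite ?andbF.
  by case: (x \in P).
have cN : #|matched N :&: P| = #|matched M :&: P|.
  apply/eqP; rewrite eqn_leq; apply/andP; split.
    have := Mmax _ (swm N M NK MK PN PM NE ME).
    by rewrite cardsw -[X in _ <= X](cardsID P) leq_add2r.
  have := Nmax _ (swm M N MK NK PM PN ME NE).
  by rewrite cardsw -[X in _ <= X](cardsID P) leq_add2r.
have swmax : max_matching_in W (sw N M).
  split; first exact: swm.
  move=> m' /Mmax h; apply: leq_trans h _.
  by rewrite cardsw cN cardsID.
exists (sw N M); split=> //; split.
  by rewrite ffunE /P porbit_id.
(* The orbit [P] contains at most one of the two [M]-fixed points [u] and [w], so the exchange
   leaves the other one missed. *)
case uP: (u \in P); last by left; rewrite ffunE uP.
right; case wP: (w \in P); last by rewrite ffunE wP.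
case/eqP: uw.
by apply: (dihedral_orbit_fixed pMK pNK pNv uP wP); rewrite pME.
Qed.

(** The blocks are the fibres, outside [U], of a labelling of the vertices by vertices. There are
    thus [#|T|] blocks, some possibly empty. *)
Definition covers (W U : {set T}) (l : T -> T) : Prop :=
  forall u v, u \in W -> v \in W -> e u v -> u \notin U -> v \notin U -> l u = l v.

Definition cover_value (W U : {set T}) (l : T -> T) : nat :=
  #|U| + \sum_k #|[set u in W :\: U | l u == k]|./2.

Lemma card_fibers (A : {set T}) (l : T -> T) :
  #|A| = \sum_k #|[set u in A | l u == k]|.
Proof.
rewrite -sum1_card (partition_big l predT) //=; apply: eq_bigr => k _.
by rewrite -sum1_card; apply: eq_bigl => u; rewrite !inE.
Qed.

(** The easy half of the formula. Matched vertices that lie in [U] or have their partner there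
    number at most 2|U|. The others are paired within their blocks, so in each block their number is
    even and at most twice the floor of half its size. *)
Lemma matched_leq_cover (W U : {set T}) (l : T -> T) (m : {ffun T -> T}) :
  matching_in W m -> covers W U l -> #|matched m| <= (cover_value W U l).*2.
Proof.
move=> /matching_inP[mK mE] cov.
pose A := [set u in matched m | (u \in U) || (m u \in U)].
rewrite -(cardsID A) doubleD; apply: leq_add.
  apply: (@leq_trans #|U :|: m @: U|).
    apply/subset_leq_card/subsetP => u; rewrite !inE => /and3P[_ _ /orP[->//|muU]].
    by apply/orP; right; rewrite -[u]mK imset_f.
  rewrite -addnn; apply: leq_trans (leq_card_setU _ _) _.
  by rewrite leq_add2l leq_imset_card.
rewrite -muln2 big_distrl /= (card_fibers _ l); apply: leq_sum => k _.
set B := [set u in matched m :\: A | l u == k].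
have BP u : (u \in B) = [&& m u != u, u \notin U, m u \notin U & l u == k].
  by rewrite !inE negb_and negb_or negbK; case: (m u =P u); case: (u \in U); case: (m u \in U).
have Bst : {in B, forall u, m u \in B}.
  move=> u; rewrite !BP mK => /and4P[mu uU muU /eqP <-]; rewrite uU muU eq_sym mu /=.
  have [eu uW] := mE _ mu.
  have [|_ muW] := mE (m u); first by rewrite mK eq_sym.
  by rewrite eq_sym; apply/eqP/cov.
have BN : {in B, forall u, m u != u} by move=> u; rewrite BP => /and4P[].
rewrite (card_involution_pairs mK Bst BN) leq_mul2r /=.
rewrite -[X in X <= _](@half_bit_double _ false) add0n -muln2 -(card_involution_pairs mK Bst BN).
apply/half_leq/subset_leq_card/subsetP => u; rewrite BP !inE => /and4P[mu -> _ ->].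
by have [_ ->] := mE _ mu.
Qed.

Lemma max_matching_missing (W : {set T}) (m : {ffun T -> T}) u v :
  max_matching_in W m -> u \in W -> v \in W -> m u = u -> m v = v -> ~~ e u v.
Proof.
move=> [/matching_inP[mK mE] mmax] uW vW mu mv; apply/negP => euv.
have uv : u != v by apply: contraTneq euv => ->; rewrite e_irr.
pose m' := [ffun x => if x == u then v else if x == v then u else m x].
have mu' x : (m x == u) = (x == u) by rewrite -{1}mu (can_eq mK).
have mv' x : (m x == v) = (x == v) by rewrite -{1}mv (can_eq mK).
have /mmax : matching_in W m'.
  apply/matching_inP; split=> x; rewrite !ffunE.
    case: (x =P u) => [->|/eqP xu]; first by rewrite eq_sym (negPf uv) eqxx.
    case: (x =P v) => [->|/eqP xv]; first by rewrite eqxx.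
    by rewrite mu' mv' (negPf xu) (negPf xv) mK.
  case: (x =P u) => [->//|/eqP xu].
  case: (x =P v) => [->|/eqP xv]; first by rewrite e_sym.
  exact: mE.
apply/negP; rewrite -ltnNge; apply: proper_card; apply/properP; split.
  apply/subsetP => x; rewrite !inE ffunE.
  case: (x =P u) => [->|_] //; first by rewrite mu eqxx.
  by case: (x =P v) => [->|_] //; rewrite mv eqxx.
by exists u; rewrite !inE ?ffunE ?mu eqxx // eq_sym.
Qed.

(* Induction on W.  If every maximum matching covers some v, put v in the cover.
   Otherwise no vertex is essential, "no maximum matching misses both" is an
   equivalence relation containing e, and its classes are the blocks. *)
Theorem tutte_berge_in (W : {set T}) : exists (m : {ffun T -> T}) (U : {set T}) (l : T -> T),
  [/\ matching_in W m, U \subset W, covers W U l &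
      #|matched m| = (cover_value W U l).*2].
Proof.
have [c] := ubnP #|W|; elim: c W => // c IHc W; rewrite ltnS => Wc.
have [m mbest] := max_matching_exists W; have [mW mmax] := mbest.
have /matching_inP[mK mE] := mW.
have [/exists_inP[v vW /forallP vall]|/exists_inPn missable] := boolP
  [exists v in W, [forall m0, matching_in W m0 ==> (#|matched m0| == #|matched m|) ==> (m0 v != v)]].
  have [|m' [U [l [m'W UW cov val]]]] := IHc (W :\ v).
    by move: Wc; rewrite (cardsD1 v) vW.
  have /matching_inP[m'K m'E] := m'W.
  have m'v : m' v = v.
    by have [//|/m'E[_]] := eqVneq (m' v) v; rewrite !inE eqxx.
  have m'W' : matching_in W m'.
    apply/matching_inP; split=> // u /m'E[-> ]; by rewrite !inE => /andP[].
  have m'lt : #|matched m'| < #|matched m|.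
    rewrite ltn_neqAle mmax // andbT; apply/eqP => h.
    by have := vall m'; rewrite m'W' h eqxx m'v eqxx.
  have vU : v \notin U by apply/negP => /(subsetP UW); rewrite !inE eqxx.
  have cov' : covers W (v |: U) l.
    move=> x y xW yW exy; rewrite !inE !negb_or => /andP[xv xU] /andP[yv yU].
    by apply: cov => //; rewrite !inE ?xv ?yv.
  have val' : cover_value W (v |: U) l = (cover_value (W :\ v) U l).+1.
    rewrite /cover_value cardsU1 vU addSn; congr (_ + _).+1.
    by apply: eq_bigr => k _; rewrite setDDl.
  exists m, (v |: U), l; split=> //.
    by rewrite subUset sub1set vW (subset_trans UW) // subD1set.
  apply/eqP; rewrite eqn_leq matched_leq_cover //= val' doubleS -val.
  (* Both matched sets have even size, so the strict gain of [m] over [m'] is at least 2, which pays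
     for adding [v] to the cover. *)
  have me : #|matched m| = #|[set [set u; m u] | u in matched m]| * 2.
    apply: card_involution_pairs => // u; rewrite !inE // mK eq_sym //.
  rewrite me; rewrite me in m'lt; rewrite val in m'lt *; lia.
have miss v : v \in W -> exists m0, max_matching_in W m0 /\ m0 v = v.
  move=> /missable/forallPn[m0]; rewrite !negb_imply andbT => /and3P[m0W /eqP m0c /eqP m0v].
  by exists m0; split=> //; split=> // m1; rewrite m0c; apply: mmax.
pose best m0 := matching_in W m0 && (#|matched m0| == #|matched m|).
have bestP m0 : reflect (max_matching_in W m0) (best m0).
  apply: (iffP andP) => [[h1 /eqP h2]|[h1 h2]]; split=> //.
    by move=> m1; rewrite h2; apply: mmax.
  by rewrite eqn_leq mmax //= h2.
pose r u v := (u == v) || [forall m0, best m0 ==> ~~ ((m0 u == u) && (m0 v == v))].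
have rP u v m0 : r u v -> max_matching_in W m0 -> m0 u = u -> m0 v = v -> u = v.
  case/orP => [/eqP//|/forallP/(_ m0)/implyP h] /bestP/h.
  by rewrite negb_and => /orP[]/eqP.
have r_refl u : r u u by rewrite /r eqxx.
have r_sym u v : r u v = r v u.
  rewrite /r eq_sym; congr (_ || _); apply: eq_forallb => m0.
  by rewrite [X in ~~ X]andbC.
have r_trans u v w : v \in W -> r u v -> r v w -> r u w.
  move=> vW ruv rvw; have [->//|uw] := eqVneq u w.
  rewrite /r (negPf uw) /=; apply/forallP => M; apply/implyP => /bestP Mb.
  apply/negP => /andP[/eqP Mu /eqP Mw].
  (* The exchange gives a maximum matching missing [v] and one of [u], [w]. Hence [v] equals that
     vertex, and since [M] misses both [u] and [w], the other relation gives [u = w]. *)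
  have [N [Nb Nv]] := miss v vW.
  have [m0 [m0b [m0v [m0u|m0w]]]] := missing_trans Mb Nb Mu Mw uw Nv.
    have uv := rP _ _ _ ruv m0b m0u m0v.
    by case/eqP: uw; rewrite uv; apply: (rP _ _ _ rvw Mb) => //; rewrite -uv.
  have vw := rP _ _ _ rvw m0b m0v m0w.
  by case/eqP: uw; rewrite -vw; apply: (rP _ _ _ ruv Mb) => //; rewrite vw.
(* As [pick] depends only on the predicate, it chooses one common representative for each class. *)
pose l u := odflt u [pick x in W | r u x].
have lP u : u \in W -> (l u \in W) && r u (l u).
  by move=> uW; rewrite /l; case: pickP => //= _; rewrite uW r_refl.
have lE u v : u \in W -> v \in W -> (l u == l v) = r u v.
  move=> uW vW; apply/eqP/idP => [h|ruv].
    have /andP[luW rul] := lP u uW; have /andP[_ rvl] := lP v vW.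
    by apply: r_trans luW rul _; rewrite r_sym h.
  rewrite /l; have -> : [pick x in W | r u x] = [pick x in W | r v x].
    apply: eq_pick => x /=; case xW: (x \in W) => //=; apply/idP/idP; last exact: r_trans.
    by apply: r_trans => //; rewrite r_sym.
  by case: pickP => //= /(_ v); rewrite vW r_refl.
have er u v : u \in W -> v \in W -> e u v -> r u v.
  move=> uW vW euv; apply/orP; right; apply/forallP => m0; apply/implyP => /bestP m0b.
  by apply/negP => /andP[/eqP m0u /eqP m0v]; have /negP := max_matching_missing m0b uW vW m0u m0v.
have cov : covers W set0 l.
  by move=> u v uW vW euv _ _; apply/eqP; rewrite lE // er.
exists m, set0, l; split=> //; first exact: sub0set.
apply/eqP; rewrite eqn_leq matched_leq_cover //= /cover_value cards0 add0n setD0.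
rewrite -muln2 big_distrl /= (card_fibers _ l); apply: leq_sum => k _.
set K := [set u in W | l u == k]; set S := [set u in matched m | l u == k].
have mW' u : m u != u -> m u \in W.
  by move=> mu; have [|_ ->] := mE (m u); rewrite // mK eq_sym.
have Sst : {in S, forall u, m u \in S}.
  move=> u; rewrite !inE mK => /andP[mu /eqP <-]; rewrite eq_sym mu /=.
  have [eu uW] := mE u mu.
  by rewrite lE ?mW' // r_sym er // mW'.
have SN : {in S, forall u, m u != u} by move=> u; rewrite !inE => /andP[].
have SK : S \subset K.
  by apply/subsetP => u; rewrite !inE => /andP[/mE[_ ->] ->].
(* Two equivalent vertices both missed by [m] are equal, so [m] misses at most one vertex of each
   block and attains the floor. *)
have D1 : #|K :\: S| <= 1.
  apply/card_le1_eqP => x y; rewrite !inE => /andP[xS /andP[xW /eqP lx]] /andP[yS /andP[yW /eqP ly]].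
  move: xS yS; rewrite lx ly eqxx !andbT !negbK => /eqP mx /eqP my.
  by apply: (rP _ _ m) => //; rewrite -lE // lx ly.
have := cardsID S K; rewrite (setIidPr SK).
have := card_involution_pairs mK Sst SN.
set s := #|[set _ | _ in _]| => -> <-; move: D1; lia.
Qed.

End TutteBerge.

(** * Certificates for the matching number *)

(** Disjoint edges choose distinct vertices of the hitting set. *)
Lemma matching_leq_hitting (n : nat) (M : {set {set 'I_n}}) (C : {set 'I_n}) :
  {in M &, forall e e' : {set 'I_n}, e != e' -> [disjoint e & e']} ->
  {in M, forall e : {set 'I_n}, exists2 v, v \in C & v \in e} -> (#|M| <= #|C|)%N.
Proof.
move=> Mdisj hit.
pose h (e : {set 'I_n}) := [pick v in C | v \in e].
have hP e : e \in M -> exists v, [/\ h e = Some v, v \in C & v \in e].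
  move=> eM; rewrite /h; case: pickP => [v /andP[vC ve]|none]; first by exists v.
  by have [v vC ve] := hit e eM; have := none v; rewrite /= vC ve.
have inj : {in M &, injective h}.
  move=> e e' eM e'M; have [v [-> _ ve]] := hP e eM; have [v' [-> _ ve']] := hP e' e'M.
  move=> [vv]; apply/eqP; apply: contraT => /(Mdisj _ _ eM e'M)/pred0Pn[].
  by exists v; rewrite /= ve vv ve'.
rewrite -(card_in_imset inj) -(card_imset C (@Some_inj _)).
apply/subset_leq_card/subsetP => _ /imsetP[e eM ->].
by have [v [-> vC _]] := hP e eM; rewrite imset_f.
Qed.

Lemma sum_leq1_eq1 (T : eqType) (l : seq T) (f : T -> nat) :
  {in l, forall x, f x <= 1} -> size l <= \sum_(x <- l) f x -> {in l, forall x, f x = 1}.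
Proof.
elim: l => [|x l IH] // f1; rewrite big_cons /= => le.
have fx : f x <= 1 by apply: f1; rewrite mem_head.
have fl : {in l, forall y, f y <= 1} by move=> y yl; apply: f1; rewrite inE yl orbT.
have ub : \sum_(y <- l) f y <= size l.
  rewrite -sum1_size big_seq [X in _ <= X]big_seq; exact: leq_sum.
move=> y; rewrite inE => /orP[/eqP ->|]; first by lia.
by apply: IH => //; lia.
Qed.

Lemma mem_flatten_count (T : eqType) (x : T) (M : seq (seq T)) :
  count (fun K => x \in K) M <= count_mem x (flatten M).
Proof.
elim: M => //= K M IH; rewrite count_cat leq_add //.
by rewrite -has_pred1 has_count; case: (count _ _).
Qed.

Lemma uniq_flatten_block (T : eqType) (x : T) (M : seq (seq T)) (K K' : seq T) :
  uniq (flatten M) -> K \in M -> K' \in M -> x \in K -> x \in K' -> K = K'.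
Proof.
elim: M => //= L M IH; rewrite cat_uniq => /and3P[_ /hasPn h uM].
have out J : J \in M -> x \in J -> x \notin L.
  by move=> JM xJ; apply: h; apply/flattenP; exists J.
rewrite !inE => /orP[/eqP->|KM] /orP[/eqP->|K'M] // xK xK'.
- by have := out _ K'M xK'; rewrite xK.
- by have := out _ KM xK; rewrite xK'.
- exact: IH.
Qed.

Section Certificates.
Variable n : nat.
Implicit Types (sigma : seq {set 'I_n}) (e : {set 'I_n}) (M O : seq (seq 'I_n)) (U : seq 'I_n).

(** The list [M] is meant to partition all vertices, the missed ones sitting in blocks of size other
    than 2, so that [flatten M] can be tested against the full vertex list. *)
Definition pair_weight M e := count (fun K => (size K == 2) && (e \subset K)) M.
Definition blocks_over O e : nat := count (fun K : seq 'I_n => e \subset K) O.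
Definition cover_weight O U e := blocks_over O e + ~~ [disjoint e & U].
Definition pair_count M := count (fun K => size K == 2) M.

(* Every weight is at most 1 and the pair weights add up to at most pair_count M, so
   the single inequality forces all pairs to be edges and all edges to be covered. *)
Definition is_certificate sigma M O U :=
  [&& perm_eq (flatten M) (enum 'I_n), perm_eq (flatten O ++ U) (enum 'I_n),
      size sigma + pair_count M <= \sum_(e <- sigma) (pair_weight M e + cover_weight O U e)
    & pair_count M == \sum_(K <- O) (size K)./2 + size U].

Lemma perm_enum_count (l : seq 'I_n) x : perm_eq l (enum 'I_n) -> count_mem x l = 1.
Proof. by move=> /seq.permP ->; rewrite count_uniq_mem ?enum_uniq // mem_enum. Qed.

Lemma card2_has e : #|e| == 2 -> exists x, x \in e.
Proof. by move=> /eqP e2; apply/set0Pn; rewrite -card_gt0 e2. Qed.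

Lemma count_blocks_leq M e x : x \in e ->
  blocks_over M e <= count_mem x (flatten M).
Proof.
move=> xe; apply: leq_trans (mem_flatten_count x M).
by apply: sub_count => K /= /subsetP; apply.
Qed.

Lemma pair_weight_leq1 M e : perm_eq (flatten M) (enum 'I_n) -> #|e| == 2 ->
  pair_weight M e <= 1.
Proof.
move=> pM /card2_has[x xe]; rewrite -(perm_enum_count x pM).
apply: leq_trans (count_blocks_leq M xe).
by apply: sub_count => K /andP[].
Qed.

Lemma cover_weight_leq1 O U e : perm_eq (flatten O ++ U) (enum 'I_n) -> #|e| == 2 ->
  cover_weight O U e <= 1.
Proof.
move=> pO e2; rewrite /cover_weight; case: (boolP [disjoint e & U]) => /= [_|].
  have [x xe] := card2_has e2.
  have := perm_enum_count x pO; rewrite count_cat => <-.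
  by rewrite addn0 (leq_trans (count_blocks_leq O xe)) ?leq_addr.
move=> /pred0Pn[x /andP[xe xU]].
have : uniq (flatten O ++ U) by rewrite (perm_uniq pO) enum_uniq.
rewrite cat_uniq => /and3P[_ /hasPn/(_ x xU) /= xO _].
by have := count_blocks_leq O xe; rewrite (count_memPn xO) leqn0 => /eqP ->.
Qed.

Lemma pair_block_eq e (K : seq 'I_n) : #|e| == 2 -> size K == 2 -> e \subset K ->
  e = [set x in K].
Proof.
move=> /eqP e2 /eqP K2 /subsetP eK; apply/eqP; rewrite eqEcard e2.
apply/andP; split; first by apply/subsetP => x /eK; rewrite inE.
by rewrite cardsE -K2 card_size.
Qed.

Lemma block_edges_leq1 sigma (K : seq 'I_n) : valid_stream sigma -> size K == 2 ->
  count (fun e => e \subset K) sigma <= 1.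
Proof.
move=> /andP[us /allP s2] K2.
apply: (@leq_trans (count_mem [set x in K] sigma)).
  rewrite -!sum1_count [X in X <= _]big_seq_cond [X in _ <= X]big_seq_cond.
  apply: eq_leq; apply: eq_bigl => e; case es: (e \in sigma) => //=.
  apply/idP/eqP => [eK|->].
    by apply: pair_block_eq => //; apply: s2.
  by apply/subsetP => x; rewrite inE.
by rewrite count_uniq_mem // leq_b1.
Qed.

Lemma sum_pair_weight sigma M : \sum_(e <- sigma) pair_weight M e =
  \sum_(K <- [seq K <- M | size K == 2]) count (fun e => e \subset K) sigma.
Proof.
rewrite /pair_weight; under eq_bigr do rewrite -sum1_count big_mkcond /=.
rewrite exchange_big /= big_filter [RHS]big_mkcond; apply: eq_bigr => K _.
case: ifP => _ /=; last by rewrite big1.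
by rewrite -big_mkcond sum1_count.
Qed.

Lemma sum_weights_leq sigma M O U : valid_stream sigma ->
  perm_eq (flatten M) (enum 'I_n) -> perm_eq (flatten O ++ U) (enum 'I_n) ->
  \sum_(e <- sigma) pair_weight M e <= pair_count M /\
  \sum_(e <- sigma) cover_weight O U e <= size sigma.
Proof.
move=> vs pM pO; have /andP[us /allP s2] := vs; split.
  rewrite sum_pair_weight /pair_count -size_filter -sum1_size.
  rewrite big_seq [X in _ <= X]big_seq; apply: leq_sum => K.
  by rewrite mem_filter => /andP[K2 _]; apply: block_edges_leq1.
rewrite -sum1_size big_seq [X in _ <= X]big_seq; apply: leq_sum => e es.
by apply: cover_weight_leq1 => //; apply: s2.
Qed.

Lemma matching_inside_leq (P : {set {set 'I_n}}) (K : seq 'I_n) :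
  {in P &, forall e e' : {set 'I_n}, e != e' -> [disjoint e & e']} ->
  {in P, forall e : {set 'I_n}, #|e| == 2 /\ e \subset K} -> #|P| <= (size K)./2.
Proof.
move=> Pd PK; have /eqP cov : \sum_(A in P) #|A| == #|cover P| by apply/trivIsetP.
rewrite -[#|P|]doubleK; apply: half_leq; apply: leq_trans (card_size K).
rewrite -[X in _ <= X]cardsE -muln2 -sum_nat_const.
rewrite (eq_bigr (fun e : {set 'I_n} => #|e|)) => [|e eP]; last by have [/eqP ->] := PK e eP.
rewrite cov; apply/subset_leq_card/bigcupsP => e eP; have [_ /subsetP eK] := PK e eP.
by apply/subsetP => x /eK; rewrite inE.
Qed.

Theorem certificate_sound sigma M O U : valid_stream sigma ->
  is_certificate sigma M O U -> MaxMatching sigma = pair_count M.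
Proof.
move=> vs /and4P[pM pO le /eqP kE].
have /andP[us /allP s2] := vs.
have [leM leO] := sum_weights_leq vs pM pO.
rewrite big_split /= in le.
have cov1 : {in sigma, forall e, cover_weight O U e = 1}.
  apply: sum_leq1_eq1 => [e es|]; last first.
    by rewrite -(leq_add2l (pair_count M)) addnC (leq_trans le) // leq_add2r.
  by apply: cover_weight_leq1 => //; apply: s2.
have sumM : \sum_(e <- sigma) pair_weight M e = pair_count M.
  apply/eqP; rewrite eqn_leq leM -(leq_add2l (size sigma)) (leq_trans le) //.
  by rewrite addnC leq_add2r.
apply/eqP; rewrite eqn_leq; apply/andP; split.
  apply/bigmax_leqP => Mt /andP[/subsetP Mts /forall_inP Mtd].
  have Ms e : e \in Mt -> e \in sigma by move=> /Mts; rewrite inE.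
  have Md : {in Mt &, forall e e' : {set 'I_n}, e != e' -> [disjoint e & e']}.
    by move=> e e' eM e'M; apply/implyP; move/forall_inP: (Mtd e eM); apply.
  (* Weak duality for an arbitrary matching [Mt]: its edges meeting [U] number at most |U|, and by
     tightness each other edge lies in exactly one block. *)
  rewrite kE -(cardsID [set e : {set 'I_n} | ~~ [disjoint e & U]]) addnC leq_add //.
    apply: (@leq_trans (\sum_(K <- O) #|[set e : {set 'I_n} in Mt | e \subset K]|)).
      rewrite -sum1_card; apply: (@leq_trans (\sum_(e in Mt) blocks_over O e)).
        rewrite [X in X <= _]big_mkcond [X in _ <= X]big_mkcond; apply: leq_sum => e _.
        rewrite !inE negbK; case eM: (e \in Mt); last by rewrite andbF.
        case: (boolP [disjoint e & U]) => //= eU.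
        by have := cov1 e (Ms e eM); rewrite /cover_weight eU addn0 => ->.
      under eq_bigr do rewrite /blocks_over -sum1_count big_mkcond /=.
      rewrite exchange_big /=; apply: leq_sum => K _.
      rewrite -sum1_card [X in _ <= X]
        (eq_bigl (fun e : {set 'I_n} => (e \in Mt) && (e \subset K))) => [|e]; last by rewrite inE.
      by rewrite big_mkcondr.
    apply: leq_sum => K _; apply: matching_inside_leq.
      by move=> e e'; rewrite !inE => /andP[eM _] /andP[e'M _]; apply: Md.
    by move=> e; rewrite inE => /andP[/Ms/s2 ? ?].
  apply: (@leq_trans #|[set x in U]|); last by rewrite cardsE card_size.
  apply: matching_leq_hitting.
    by move=> e e'; rewrite !inE => /andP[eM _] /andP[e'M _]; apply: Md.
  move=> e; rewrite !inE => /andP[_ /pred0Pn[x /andP[xe xU]]].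
  by exists x; rewrite ?inE.
have pw1 e : e \in sigma -> pair_weight M e <= 1.
  by move=> es; apply: pair_weight_leq1 => //; apply: s2.
(* Conversely, the edges of weight 1 are a matching since the blocks of [M] are disjoint, and their
   number is the total pair weight. *)
pose Mt := [set e in sigma | 0 < pair_weight M e].
have <- : #|Mt| = pair_count M.
  rewrite -sumM -sum1_card [LHS](eq_bigl (fun e => (e \in sigma) && (0 < pair_weight M e))).
    rewrite big_mkcondr /= [RHS]big_uniq //=; apply: eq_bigr => e /pw1.
    by case: (pair_weight M e) => [|[|k]].
  by move=> e; rewrite inE.
apply: leq_bigmax_cond; apply/andP; split.
  by apply/subsetP => e; rewrite !inE => /andP[].
have uM : uniq (flatten M) by rewrite (perm_uniq pM) enum_uniq.
have blockP e : e \in Mt -> exists2 K, K \in M & e = [set x in K].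
  rewrite inE => /andP[/s2 e2]; rewrite -has_count => /hasP[K KM /andP[K2 eK]].
  by exists K => //; apply: pair_block_eq.
apply/forall_inP => e /blockP[K KM ->]; apply/forall_inP => e' /blockP[K' K'M ->].
apply/implyP; apply: contraR => /pred0Pn[x]; rewrite /= !inE => /andP[xK xK'].
by rewrite (uniq_flatten_block uM KM K'M xK xK').
Qed.

(** The Tutte-Berge formula on all vertices provides it. One possibly empty block per vertex and per
    label fixes the lengths of [M] and [O], on which the length of the help depends. *)
Theorem certificate_exists sigma : valid_stream sigma ->
  exists M O U, [/\ is_certificate sigma M O U, size M = n & size O = n].
Proof.
move=> vs; have /andP[us /allP s2] := vs.
pose adj (u v : 'I_n) := (u != v) && ([set u; v] \in sigma).
have adj_sym : symmetric adj by move=> u v; rewrite /adj eq_sym setUC.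
have adj_irr : irreflexive adj by move=> u; rewrite /adj eqxx.
have [m [U [l [/matching_inP[mK mE] _ cov val]]]] := tutte_berge_in adj_sym adj_irr setT.
(* A matched pair is listed at its smaller end only, the block of the larger end being empty; this
   lists every vertex once. *)
pose pairs (u : 'I_n) : seq 'I_n :=
  if u < m u then [:: u; m u] else if m u == u then [:: u] else [::].
pose M := [seq pairs u | u <- enum 'I_n].
pose O := [seq enum [set u in ~: U | l u == k] | k <- enum 'I_n].
have count_flatten x (h : 'I_n -> seq 'I_n) :
    count_mem x (flatten [seq h u | u <- enum 'I_n]) = \sum_u count_mem x (h u).
  by rewrite count_flatten -map_comp sumnE big_map big_enum.
have perm_enum (w : seq 'I_n) : (forall x, count_mem x w = 1) -> perm_eq w (enum 'I_n).
  move=> w1; apply/allP => x _ /=.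
  by rewrite w1 count_uniq_mem ?enum_uniq // mem_enum.
have sum_pick (g : 'I_n -> nat) x : \sum_u g u * (u == x) = g x.
  rewrite (bigD1 x) //= eqxx muln1 big1 ?addn0 // => u /negPf ->.
  by rewrite muln0.
have pM : perm_eq (flatten M) (enum 'I_n).
  apply: perm_enum => x; rewrite count_flatten.
  rewrite (eq_bigr (fun u : 'I_n => ((u < m u) + (m u == u)) * (u == x) + (u < m u) * (u == m x))).
    rewrite big_split /= !sum_pick mK.
    by rewrite -(inj_eq val_inj) /=; case: ltngtP.
  move=> u _; rewrite /pairs; have -> : (u == m x) = (m u == x).
    by rewrite -(can_eq mK) mK.
  case: ltnP => h /=; last by case: (m u =P u) => _ /=; rewrite ?mul1n ?addn0.
  have -> : (m u == u) = false by rewrite -(inj_eq val_inj) /= gtn_eqF.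
  by rewrite !mul1n addn0.
have pO : perm_eq (flatten O ++ enum U) (enum 'I_n).
  apply: perm_enum => x; rewrite count_cat count_flatten.
  have cE (A : {set 'I_n}) : count_mem x (enum A) = (x \in A).
    by rewrite count_uniq_mem ?enum_uniq // mem_enum.
  rewrite cE (eq_bigr (fun k => (x \notin U) * (k == l x))) => [|k _].
    by rewrite (sum_pick (fun=> (x \notin U) : nat)); case: (x \in U).
  by rewrite cE !inE eq_sym; case: (x \in U); rewrite ?mul1n.
have pcE : pair_count M = \sum_(u : 'I_n) (u < m u).
  rewrite /pair_count count_map -sum1_count big_mkcond big_enum /=.
  apply: eq_bigr => u _; by rewrite /pairs; case: (u < m u) => //; case: (m u == u).
have mhalf : #|matched m| = (pair_count M).*2.
  rewrite pcE -addnn; have {2}-> : \sum_(u : 'I_n) (u < m u) = \sum_(u : 'I_n) (m u < u).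
    by rewrite (reindex_inj (can_inj mK)); apply: eq_bigr => u _; rewrite mK.
  rewrite -big_split -sum1_card big_mkcond; apply: eq_bigr => u _ /=.
  by rewrite inE -(inj_eq val_inj) /=; case: ltngtP.
exists M, O, (enum U); split; [|by rewrite size_map size_enum_ord..].
rewrite /is_certificate pM pO /=; apply/andP; split; last first.
  have -> : pair_count M = cover_value setT U l by apply: double_inj; rewrite -val mhalf.
  rewrite /cover_value -cardE addnC eqn_add2r big_map big_enum /=.
  by apply/eqP; apply: eq_bigr => k _; rewrite -cardE setTD.
rewrite big_split /= addnC leq_add //.
  rewrite sum_pair_weight /pair_count -size_filter -sum1_size.
  rewrite big_seq [X in _ <= X]big_seq; apply: leq_sum => K.
  rewrite mem_filter => /andP[+ /mapP[u _ KE]]; rewrite KE /pairs.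
  case: ltnP => h; last by case: ifP.
  move=> _; rewrite -has_count; apply/hasP; exists [set u; m u].
    have : m u != u by rewrite -(inj_eq val_inj) gtn_eqF.
    by move=> /mE[/andP[_ ->]].
  by apply/subsetP => x; rewrite !inE.
rewrite -sum1_size big_seq [X in _ <= X]big_seq; apply: leq_sum => e es.
rewrite /cover_weight; case: (boolP [disjoint e & enum U]) => dis; last by rewrite addn1.
have /cards2P[u [v [uv eE]]] := s2 e es.
rewrite addn0 -has_count; apply/hasP; exists (enum [set w in ~: U | l w == l u]).
  by apply/mapP; exists (l u); rewrite ?mem_enum.
have out w : w \in e -> w \notin U.
  by move=> we; have := disjointFr dis we; rewrite mem_enum => ->.
have uU : u \notin U by apply: out; rewrite eE !inE eqxx.
have vU : v \notin U by apply: out; rewrite eE !inE eqxx orbT.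
apply/subsetP => w; rewrite eE mem_enum !inE => /orP[]/eqP->; rewrite ?uU ?vU ?eqxx //=.
by apply/eqP; symmetry; apply: cov; rewrite ?inE // /adj uv -eE es.
Qed.

End Certificates.

Import Order.TTheory GRing.Theory Num.Theory.
Local Open Scope ring_scope.

(** * Lower bound *)

Section Distributions.
Variables (R : realType) (S : finType).
Implicit Types (d : {ffun S -> R}) (K : S -> {ffun S -> R}).

Definition dirac (x : S) : {ffun S -> R} := [ffun y => (x == y)%:R].

Lemma dirac_is_dist x : is_dist (dirac x).
Proof.
split=> [y|]; first by rewrite ffunE ler0n.
rewrite (bigD1 x) //= ffunE eqxx big1 ?addr0 // => y yx.
by rewrite ffunE eq_sym (negPf yx).
Qed.

Lemma push_is_dist d K : is_dist d -> (forall x, is_dist (K x)) -> is_dist (push d K).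
Proof.
move=> [d0 d1] KP; split=> [y|].
  by rewrite ffunE sumr_ge0 // => x _; rewrite mulr_ge0 //; case: (KP x).
under eq_bigr do rewrite ffunE.
rewrite exchange_big /= -d1; apply: eq_bigr => x _.
by rewrite -mulr_sumr; case: (KP x) => _ ->; rewrite mulr1.
Qed.

Lemma foldl_push_is_dist (I : Type) (K : I -> S -> {ffun S -> R}) (l : seq I) d :
  is_dist d -> (forall i x, is_dist (K i x)) ->
  is_dist (foldl (fun d i => push d (K i)) d l).
Proof.
move=> dP KP; elim: l d dP => //= i l IHl d dP.
by apply: IHl; apply: push_is_dist.
Qed.

(** A run is linear in its starting distribution; this separates Alice's part of the stream from
    Bob's. *)
Lemma foldl_push_dirac (I : Type) (K : I -> S -> {ffun S -> R}) (l : seq I) d y :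
  foldl (fun d i => push d (K i)) d l y =
  \sum_x d x * foldl (fun d i => push d (K i)) (dirac x) l y.
Proof.
elim/last_ind: l y => [|l i IHl] y.
  rewrite /= (bigD1 y) //= ffunE eqxx mulr1 big1 ?addr0 // => x xy.
  by rewrite ffunE (negPf xy) mulr0.
rewrite foldl_rcons ffunE.
under eq_bigr do rewrite IHl big_distrl /=.
rewrite exchange_big /=; apply: eq_bigr => x _.
rewrite foldl_rcons ffunE mulr_sumr; apply: eq_bigr => z _.
by rewrite mulrA.
Qed.

(** Under [d] the mean number of elements of [A] for which the state is bad is at most a third of
    [#|A|], and some state in the support does not exceed the mean. *)
Lemma exists_state_third d (W : finType) (bad : S -> pred W) (A : {set W}) :
  is_dist d -> (forall w, \sum_(s | bad s w) d s <= 3^-1) ->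
  exists2 s, 0 < d s & (3 * #|[set w in A | bad s w]| <= #|A|)%N.
Proof.
move=> [d0 d1] badP.
have [/existsP[s /andP[]]|/existsPn none] :=
  boolP [exists s, (0 < d s) && (3 * #|[set w in A | bad s w]| <= #|A|)%N].
  by exists s.
exfalso.
have lb : \sum_s d s * (3 * #|[set w in A | bad s w]|)%N%:R >= (#|A|.+1)%:R.
  rewrite -[X in X <= _]mul1r -[X in X * _ <= _]d1 mulr_suml; apply: ler_sum => s _.
  have := none s; rewrite negb_and -leNgt -ltnNge.
  case/orP => [ds0|lt].
    have -> : d s = 0 by apply/eqP; rewrite eq_le ds0 d0.
    by rewrite !mul0r.
  by apply: ler_wpM2l; [exact: d0 | rewrite ler_nat].
have ub : \sum_s d s * (3 * #|[set w in A | bad s w]|)%N%:R <= #|A|%:R.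
  have -> : \sum_s d s * (3 * #|[set w in A | bad s w]|)%N%:R =
     \sum_(w in A) 3 * \sum_(s | bad s w) d s.
    under [RHS]eq_bigr do rewrite mulr_sumr.
    rewrite (exchange_big_dep predT) //=; apply: eq_bigr => s _.
    rewrite natrM -sum1_card natr_sum mulrCA mulr_sumr.
    rewrite mulr_sumr -big_filter big_filter.
    by apply: eq_big => w; rewrite ?inE // mulr1.
  rewrite -sum1_card natr_sum; apply: ler_sum => w _.
  by have := badP w; lra.
by have := le_trans lb ub; rewrite ler_nat ltnn.
Qed.

(** Each new state is chosen against the elements that are bad for all previous ones, and cuts their
    number by three. *)
Lemma exists_states_cube d (W : finType) (bad : S -> pred W) (k : nat) :
  is_dist d -> (forall w, \sum_(s | bad s w) d s <= 3^-1) ->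
  exists T : k.-tuple S, (forall s, s \in T -> 0 < d s) /\
    (3 ^ k * #|[set w | all (bad^~ w) T]| <= #|W|)%N.
Proof.
move=> dP badP; elim: k => [|k [T [Tpos Tle]]].
  exists [tuple]; split=> // ; rewrite mul1n max_card //.
have [s spos sle] := exists_state_third [set w | all (bad^~ w) T] dP badP.
exists [tuple of s :: T]; split.
  by move=> s'; rewrite inE => /orP[/eqP->//|/Tpos].
apply: leq_trans Tle; rewrite expnSr -mulnA leq_mul2l; apply/orP; right.
apply: leq_trans sle; rewrite leq_mul2l /=.
apply/subset_leq_card/subsetP => w; rewrite !inE /=.
by case/andP => -> ->.
Qed.

End Distributions.

(** * The graph of an INDEX instance *)

Section IndexGraph.
Variables (n m : nat).
Hypothesis m4 : (4 * m <= n)%N.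

Lemma gadget_card : (#|{: 'I_4 * 'I_m}| <= n)%N.
Proof. by rewrite card_prod !card_ord. Qed.

(** Four copies of [m]: copies 0 and 2 are the sides of Alice's bipartite graph, copies 1 and 3 the
    free ends of Bob's pendant edges. Any further vertices are isolated. *)
Definition vtx (k : 'I_4) (i : 'I_m) : 'I_n :=
  widen_ord gadget_card (enum_rank (k, i)).

Lemma vtx_eq k i k' i' : (vtx k i == vtx k' i') = (k == k') && (i == i').
Proof.
rewrite -(inj_eq val_inj) /= (inj_eq val_inj) (inj_eq enum_rank_inj).
by rewrite xpair_eqE.
Qed.

Definition k0 : 'I_4 := @Ordinal 4 0 isT.
Definition k1 : 'I_4 := @Ordinal 4 1 isT.
Definition k2 : 'I_4 := @Ordinal 4 2 isT.
Definition k3 : 'I_4 := @Ordinal 4 3 isT.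

Definition bit_edge (q : 'I_m * 'I_m) : {set 'I_n} := [set vtx k0 q.1; vtx k2 q.2].
Definition left_pendant (i : 'I_m) : {set 'I_n} := [set vtx k0 i; vtx k1 i].
Definition right_pendant (i : 'I_m) : {set 'I_n} := [set vtx k2 i; vtx k3 i].

Definition alice_stream (x : {set 'I_m * 'I_m}) : seq {set 'I_n} :=
  [seq bit_edge q | q <- enum x].
Definition bob_stream (q : 'I_m * 'I_m) : seq {set 'I_n} :=
  [seq left_pendant i | i <- enum [set~ q.1]] ++
  [seq right_pendant i | i <- enum [set~ q.2]].

Lemma bit_edge_inj : injective bit_edge.
Proof.
move=> [i j] [i' j'] /setP h.
have := h (vtx k0 i); rewrite !inE !vtx_eq !eqxx /= orbF => /esym/eqP ->.
by have := h (vtx k2 j); rewrite !inE !vtx_eq !eqxx /= => /esym/eqP ->.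
Qed.

Lemma left_pendant_inj : injective left_pendant.
Proof.
move=> i i' /setP/(_ (vtx k0 i)); rewrite !inE !vtx_eq !eqxx /= orbF.
by move/esym/eqP.
Qed.

Lemma right_pendant_inj : injective right_pendant.
Proof.
move=> i i' /setP/(_ (vtx k2 i)); rewrite !inE !vtx_eq !eqxx /= orbF.
by move/esym/eqP.
Qed.

Lemma pendants_neq i j : left_pendant i != right_pendant j.
Proof.
by apply/eqP => /setP/(_ (vtx k0 i)); rewrite !inE !vtx_eq !eqxx.
Qed.

Lemma mem_index_graph x q e : e \in graph_of (alice_stream x ++ bob_stream q) =
  [|| e \in bit_edge @: x, e \in left_pendant @: [set~ q.1] |
      e \in right_pendant @: [set~ q.2]].
Proof.
rewrite inE !mem_cat; congr [|| _, _ | _].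
- by apply/mapP/imsetP => -[y yx ->]; exists y; rewrite ?mem_enum // -mem_enum.
- by apply/mapP/imsetP => -[y yx ->]; exists y; rewrite ?mem_enum // -mem_enum.
- by apply/mapP/imsetP => -[y yx ->]; exists y; rewrite ?mem_enum // -mem_enum.
Qed.

Lemma index_stream_valid x q : valid_stream (alice_stream x ++ bob_stream q).
Proof.
apply/andP; split.
  rewrite cat_uniq cat_uniq !map_inj_uniq ?enum_uniq //=.
  - rewrite andbT; apply/andP; split.
      apply/hasPn => e; rewrite mem_cat; apply/contraTN => /mapP[[i j] _ ->].
      rewrite negb_or; apply/andP; split; apply/mapP => -[i' _] /setP h.
        by have := h (vtx k2 j); rewrite !inE !vtx_eq !eqxx.
      by have := h (vtx k0 i); rewrite !inE !vtx_eq !eqxx.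
    apply/hasPn => e /mapP[j _ ->]; apply/mapP => -[i _ h].
    by have := pendants_neq i j; rewrite h eqxx.
  - exact: right_pendant_inj.
  - exact: left_pendant_inj.
  - exact: bit_edge_inj.
rewrite !all_cat; apply/and3P; split; apply/allP => _ /mapP[y _ ->];
  by rewrite cards2 vtx_eq.
Qed.

(** The 2(m-1) bipartite vertices carrying a pendant hit every edge except [bit_edge q]. Conversely
    the pendants are disjoint from one another and from [bit_edge q]. *)
Lemma index_matching_number x q :
  MaxMatching (alice_stream x ++ bob_stream q) = (2 * m.-1 + (q \in x))%N.
Proof.
case: q => i j; set q := (i, j).
pose L := [set left_pendant a | a in [set~ i]].
pose Rt := [set right_pendant a | a in [set~ j]].
have cC (a : 'I_m) : #|[set~ a]| = m.-1 by rewrite cardsC1 card_ord.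
have cL : #|L| = m.-1 by rewrite card_imset ?cC //; exact: left_pendant_inj.
have cR : #|Rt| = m.-1 by rewrite card_imset ?cC //; exact: right_pendant_inj.
have LR : [disjoint L & Rt].
  apply/pred0P => e /=; apply/andP => -[/imsetP[a _ ->] /imsetP[b _ h]].
  by have := pendants_neq a b; rewrite h eqxx.
apply/eqP; rewrite eqn_leq; apply/andP; split.
  apply/bigmax_leqP => M /andP[/subsetP ME /forall_inP Mm].
  have Mdisj : {in M &, forall e e' : {set 'I_n}, e != e' -> [disjoint e & e']}.
    by move=> e e' eM e'M; apply/implyP; move/forall_inP: (Mm e eM); apply.
  pose C := [set vtx k0 a | a in [set~ i]] :|: [set vtx k2 a | a in [set~ j]].
  have cC2 : (#|C| <= 2 * m.-1)%N.
    apply: leq_trans (leq_card_setU _ _) _.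
    by rewrite mul2n -addnn leq_add // (leq_trans (leq_imset_card _ _)) ?cC.
  have hit e : e \in M -> e != bit_edge q \/ e \notin bit_edge @: x ->
      exists2 v, v \in C & v \in e.
    move=> eM; have := ME e eM; rewrite mem_index_graph => /or3P[ex|ex|ex] ne.
    - case: ne => [|]; last by rewrite ex.
      case/imsetP: ex => -[a b] _ -> ne.
      have [ai|ai] := eqVneq a i; last first.
        by exists (vtx k0 a); rewrite !inE ?eqxx // imset_f // !inE.
      have [bj|bj] := eqVneq b j; first by rewrite ai bj eqxx in ne.
      exists (vtx k2 b); rewrite !inE ?eqxx ?orbT // [X in _ || X]imset_f ?orbT //.
      by rewrite !inE.
    - case/imsetP: ex => a ai ->; exists (vtx k0 a); rewrite !inE ?eqxx //.
      by rewrite imset_f.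
    - case/imsetP: ex => a ai ->; exists (vtx k2 a); rewrite !inE ?eqxx //.
      by rewrite [X in _ || X]imset_f ?orbT.
  case: (boolP (q \in x)) => qx.
    rewrite addn1 (cardsD1 (bit_edge q)) -[X in (_ <= X)%N]add1n leq_add ?leq_b1 //.
    apply: leq_trans cC2; apply: matching_leq_hitting.
      by move=> e e' /setD1P[_ eM] /setD1P[_ e'M]; apply: Mdisj.
    by move=> e /setD1P[ne eM]; apply: hit => //; left.
  rewrite addn0; apply: leq_trans cC2; apply: matching_leq_hitting => // e eM.
  apply: hit => //; have [->|] := eqVneq e (bit_edge q); last by left.
  by right; apply: contra qx => /imsetP[q' q'x /bit_edge_inj ->].
pose M := (if q \in x then [set bit_edge q] else set0) :|: (L :|: Rt).
have MP e : e \in M -> [\/ q \in x /\ e = bit_edge q, exists2 a, a != i & e = left_pendant a |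
     exists2 a, a != j & e = right_pendant a].
  rewrite !inE => /orP[|/orP[]].
  - case: ifP => qx; rewrite !inE // => /eqP ->; by constructor 1.
  - by move/imsetP=> [a]; rewrite !inE => h ->; constructor 2; exists a.
  - by move/imsetP=> [a]; rewrite !inE => h ->; constructor 3; exists a.
have cM : #|M| = (2 * m.-1 + (q \in x))%N.
  rewrite cardsU (disjoint_setI0 _); last first.
    rewrite -setI_eq0; apply/eqP/setP => e; rewrite !inE.
    case: ifP => qx; rewrite !inE //; apply/andP => -[/eqP -> /orP[]/imsetP[a _ /setP h]].
      by have := h (vtx k2 j); rewrite !inE !vtx_eq !eqxx.
    by have := h (vtx k0 i); rewrite !inE !vtx_eq !eqxx.
  rewrite cards0 subn0 cardsU (disjoint_setI0 LR) cards0 subn0 cL cR addnn -mul2n addnC.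
  by congr addn; case: ifP => _; rewrite ?cards1 ?cards0.
rewrite -cM; apply: leq_bigmax_cond; apply/andP; split.
  apply/subsetP => e /MP[[qx ->]|[a ai ->]|[a aj ->]]; rewrite mem_index_graph.
  - by rewrite imset_f.
  - by rewrite [X in [|| _, X | _]]imset_f ?orbT // !inE.
  - by rewrite [X in [|| _, _ | X]]imset_f ?orbT // !inE.
have disj (e e' : {set 'I_n}) : (forall v, v \in e -> v \in e' -> false) -> [disjoint e & e'].
  by move=> h; apply/pred0P => v /=; apply/andP => -[ve ve']; have := h v ve ve'.
apply/forall_inP => e eM; apply/forall_inP => e' e'M; apply/implyP => ee'.
case/MP: eM ee' => [[qx ->]|[a ai ->]|[a aj ->]];
case/MP: e'M => [[qx' ->]|[b bi ->]|[b bj ->]]; rewrite ?eqxx // => ee';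
apply: disj => v; rewrite !inE => /orP[]/eqP->; rewrite !vtx_eq /= ?orbF ?andbF //.
- by rewrite eq_sym (negPf bi).
- by rewrite eq_sym (negPf bj).
- by rewrite (negPf ai).
- by move=> /eqP ab; rewrite ab eqxx in ee'.
- by move=> /eqP ab; rewrite ab eqxx in ee'.
- by rewrite (negPf aj).
- by move=> /eqP ab; rewrite ab eqxx in ee'.
- by move=> /eqP ab; rewrite ab eqxx in ee'.
Qed.

End IndexGraph.

Lemma foldl_map (S T U : Type) (f : S -> U -> S) (h : T -> U) (l : seq T) (z : S) :
  foldl f z (map h l) = foldl (fun x y => f x (h y)) z l.
Proof. by elim: l z => //= y l IHl z; apply: IHl. Qed.

(** * Decoding INDEX from the states of a scheme *)

Section SchemeToIndex.
Variables (R : realType) (n m : nat) (V : verifier R n).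
Variables (prover : seq {set 'I_n} -> seq bool) (hb : nat).
Hypothesis m4 : (4 * m <= n)%N.
Hypothesis Vscheme : is_scheme (@MaxMatching n) V prover hb.

Notation S := 'I_(2 ^ vspace V).
Notation Q := ('I_m * 'I_m)%type.

Let kernel (i : {set 'I_n} + bool) : S -> {ffun S -> R} :=
  match i with inl e => vstep V e | inr b => vread V b end.

Let evolve (l : seq ({set 'I_n} + bool)) (d : {ffun S -> R}) :=
  foldl (fun d i => push d (kernel i)) d l.

Let bob_input (q : Q) (w : seq bool) : seq ({set 'I_n} + bool) :=
  map inl (bob_stream m4 q) ++ map inr w.

Let alice_state (x : {set Q}) := evolve (map inl (alice_stream m4 x)) (vinit V).

Let answer (b : bool) : option nat := Some (2 * m.-1 + b)%N.

Let acc (s : S) (q : Q) (w : seq bool) (b : bool) : R :=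
  \sum_(y | vout V y == answer b) evolve (bob_input q w) (dirac R s) y.

Let kernel_is_dist i x : is_dist (kernel i x).
Proof. by case: i => a; case: Vscheme => -[_ [h1 h2]] _ /=. Qed.

Let evolve_is_dist l d : is_dist d -> is_dist (evolve l d).
Proof. by move=> dP; apply: foldl_push_is_dist. Qed.

Let alice_state_is_dist x : is_dist (alice_state x).
Proof. by apply: evolve_is_dist; case: Vscheme => -[]. Qed.

Let prob_out_split x q w P :
  prob_out V (alice_stream m4 x ++ bob_stream m4 q) w P =
  \sum_s alice_state x s * \sum_(y | P (vout V y)) evolve (bob_input q w) (dirac R s) y.
Proof.
rewrite /prob_out; under [RHS]eq_bigr do rewrite mulr_sumr.
rewrite exchange_big /=; apply: eq_bigr => y _.
rewrite /evolve -foldl_push_dirac /alice_state /evolve /bob_input.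
by rewrite foldl_cat (foldl_map _ inr) !(foldl_map _ inl) /run foldl_cat.
Qed.

Let acc_le1 s q w b : acc s q w b <= 1.
Proof.
have [p0 p1] := evolve_is_dist (bob_input q w) (dirac_is_dist R s).
rewrite -p1 [X in _ <= X](bigID (fun y => vout V y == answer b)) /= lerDl.
by apply: sumr_ge0.
Qed.

(** Probability exactly 1 is the right threshold: perfect completeness guarantees it from every
    state that Alice can reach. *)
Let certified (s : S) (q : Q) (w : seq bool) (b : bool) := acc s q w b == 1.

(** A mean of numbers at most 1 can equal 1 only if they are all 1 on the support. *)
Let certified_honest (x : {set Q}) q s : 0 < alice_state x s ->
  certified s q (prover (alice_stream m4 x ++ bob_stream m4 q)) (q \in x).
Proof.
move=> spos; set w := prover _.
have [_ [_ [compl _]]] := Vscheme.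
have := compl _ (index_stream_valid m4 x q).
rewrite prob_out_split index_matching_number -/w.
have [d0 d1] := alice_state_is_dist x.
rewrite -[X in _ = X -> _]d1 => h.
have : \sum_s alice_state x s * (1 - acc s q w (q \in x)) = 0.
  under eq_bigr do rewrite mulrBr mulr1.
  by rewrite sumrB -h subrr.
move/psumr_eq0P => h0.
have /eqP : alice_state x s * (1 - acc s q w (q \in x)) = 0.
  by apply: h0 => // i _; rewrite mulr_ge0 // subr_ge0.
by rewrite mulf_eq0 (gt_eqF spos) /= subr_eq0 eq_sym.
Qed.

(** From a state certifying the wrong bit, a wrong value is output with probability 1, so soundness
    bounds the mass of such states. *)
Let certified_wrong (x : {set Q}) q w : \sum_(s | certified s q w (q \notin x)) alice_state x s <= 3^-1.
Proof.
have [_ [_ [_ sound]]] := Vscheme.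
apply: le_trans (sound _ w (index_stream_valid m4 x q)).
rewrite prob_out_split index_matching_number.
have [d0 _] := alice_state_is_dist x.
rewrite big_mkcond /=; apply: ler_sum => s _.
have p0 y := (evolve_is_dist (bob_input q w) (dirac_is_dist R s)).1 y.
case: ifP => [/eqP accs|_]; last by rewrite mulr_ge0 // sumr_ge0.
rewrite -[X in X <= _]mulr1 ler_wpM2l // -[X in X <= _]accs /acc.
rewrite big_mkcond [X in _ <= X]big_mkcond /=; apply: ler_sum => y _.
case: ifP => [/eqP ->|_]; last by case: ifP.
have -> // : (answer (q \notin x) != Some (2 * m.-1 + (q \in x))%N) && (answer (q \notin x) != None).
by rewrite andbT /answer; case: (q \in x); apply/eqP => -[]; lia.
Qed.

(* The true bit is always consistent with the states sampled in T, so a position is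
   lost only when both bits are; at most half of the positions are. *)
Let consistent (T : hb.+2.-tuple S) (q : Q) (b : bool) :=
  [exists w : {bseq hb of bool}, all (fun s => certified s q w b) T].

Let ambiguous (T : hb.+2.-tuple S) := [set q | consistent T q true && consistent T q false].

Let decodes (T : hb.+2.-tuple S) (x : {set Q}) :=
  [forall q, consistent T q (q \in x)] && (#|ambiguous T| <= (m ^ 2)./2)%N.

Let card_help : (#|{: {bseq hb of bool}}| <= 2 ^ hb.+1)%N.
Proof.
rewrite card_bseq card_bool; elim: hb.+1 => [|k IHk]; first by rewrite big_ord0.
by rewrite big_ord_recr /= expnS mul2n -addnn leq_add2r.
Qed.

Let exists_decodes (x : {set Q}) : exists T, decodes T x.
Proof.
pose bad s (qw : Q * {bseq hb of bool}) := certified s qw.1 qw.2 (qw.1 \notin x).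
have [|T [Tpos Tle]] := @exists_states_cube _ _ _ _ bad hb.+2 (alice_state_is_dist x).
  by move=> [q w]; apply: certified_wrong.
have cons q : consistent T q (q \in x).
  have [_ [psize _]] := Vscheme.
  have sz := psize _ (index_stream_valid m4 x q).
  apply/existsP; exists (Bseq sz); apply/allP => s sT /=.
  by apply: certified_honest; apply: Tpos.
exists T; apply/andP; split; first by apply/forallP.
set bads := [set w | all (bad^~ w) T] in Tle.
have amb : (#|ambiguous T| <= #|bads|)%N.
  apply: leq_trans (leq_imset_card fst _).
  apply/subset_leq_card/subsetP => q; rewrite inE => /andP[ct cf].
  have : consistent T q (q \notin x) by case: (q \in x).
  case/existsP => w wP; apply/imsetP; exists (q, w) => //.
  by rewrite inE.
(* There are at most 2^(hb+1) help strings of length at most [hb]; with hb + 2 states, each cutting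
   by at least 2, at most m^2/2 bad pairs survive. *)
have badN : (2 ^ hb.+2 * #|bads| <= m ^ 2 * 2 ^ hb.+1)%N.
  apply: (@leq_trans (3 ^ hb.+2 * #|bads|)).
    by rewrite leq_mul2r leq_exp2r ?orbT.
  apply: leq_trans Tle _; rewrite card_prod card_prod !card_ord.
  by rewrite leq_mul // card_help.
apply: leq_trans amb _; rewrite -[#|bads|]doubleK half_leq //.
have : (2 ^ hb.+1 * #|bads|.*2 <= 2 ^ hb.+1 * m ^ 2)%N.
  by rewrite -mul2n mulnA -expnSr (leq_trans badN) // mulnC.
by rewrite leq_mul2l expn_eq0.
Qed.

(** Outside the ambiguous positions [T] determines [x], so [x] is known from its trace on at most
    m^2/2 positions. *)
Let card_decodes T : (#|[set x | decodes T x]| <= 2 ^ (m ^ 2)./2)%N.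
Proof.
have [amb|amb] := leqP #|ambiguous T| (m ^ 2)./2; last first.
  rewrite [X in (X <= _)%N](_ : _ = 0%N) //; apply: eq_card0 => x.
  by rewrite !inE /decodes leqNgt amb andbF.
apply: (@leq_trans #|powerset (ambiguous T)|); last by rewrite card_powerset leq_exp2l.
have inj : {in [set x | decodes T x] &, injective (fun x => x :&: ambiguous T)}.
  move=> x y; rewrite !inE => /andP[/forallP xc _] /andP[/forallP yc _] /setP xy.
  apply/setP => q; have := xy q; rewrite !inE.
  have := xc q; have := yc q.
  by do 2![case: (q \in _)] => // -> ->.
rewrite -(card_in_imset inj); apply/subset_leq_card/subsetP => _ /imsetP[x _ ->].
by rewrite inE subsetIr.
Qed.

(** Counting: 2^(v(hb+2)) tuples of states, each decoding to at most 2^(m^2/2) sets, must account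
    for all 2^(m^2) sets. *)
Lemma scheme_index_bound : (m ^ 2 <= 2 * (vspace V * hb.+2))%N.
Proof.
have : (2 ^ (m ^ 2) <= 2 ^ (vspace V * hb.+2 + (m ^ 2)./2))%N.
  have {1}-> : (m ^ 2)%N = #|{: Q}| by rewrite card_prod !card_ord.
  rewrite -cardsT -card_powerset powersetT.
  apply: (@leq_trans (\sum_T #|[set x | decodes T x]|)).
    rewrite -sum1_card; under [X in (_ <= X)%N]eq_bigr do rewrite -sum1_card big_mkcond.
    rewrite exchange_big /= big_mkcond; apply: leq_sum => x _.
    have [T Tx] := exists_decodes x.
    by case: ifP => // _; rewrite (bigD1 T) //= inE Tx.
  apply: (@leq_trans (\sum_(T : hb.+2.-tuple S) 2 ^ (m ^ 2)./2)).
    by apply: leq_sum => T _; apply: card_decodes.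
  by rewrite sum_nat_const card_tuple card_ord -expnM -expnD.
rewrite leq_exp2l //; move: (m ^ 2)%N (vspace V * _)%N => a b; lia.
Qed.

End SchemeToIndex.

Theorem scheme_lower_bound (R : realType) (n : nat) (V : verifier R n)
    (prover : seq {set 'I_n} -> seq bool) (hb : nat) : (4 <= n)%N ->
  is_scheme (@MaxMatching n) V prover hb ->
  384^-1 * (n ^ 2)%:R <= (maxn hb 1 * maxn (vspace V) 1)%:R :> R.
Proof.
move=> n4 Vs; have m4 : (4 * (n %/ 4) <= n)%N by lia.
have := scheme_index_bound m4 Vs.
set v := vspace V; set m := (n %/ 4)%N => h.
have nm : (n <= 8 * m)%N by rewrite /m; lia.
(* The constant is 8^2 * 2 * 3, from n <= 8m, the factor 2 of the index bound, and hb + 2 <= 3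
   max(hb, 1). *)
have : (n ^ 2 <= 384 * (maxn hb 1 * maxn v 1))%N.
  have h1 : (v * hb.+2 <= maxn v 1 * (3 * maxn hb 1))%N by apply: leq_mul; lia.
  have h2 : (n ^ 2 <= (8 * m) ^ 2)%N by rewrite leq_exp2r.
  move: h h1 h2; rewrite expnMn; set X := (_ * hb.+2)%N.
  rewrite mulnCA [(maxn v 1 * _)%N]mulnC; lia.
rewrite -(ler_nat R) natrM; lra.
Qed.

(** * From streaming machines to schemes *)

Lemma card_leq_cancel (A B : finType) : (#|A| <= #|B|)%N ->
  exists (code : A -> B) (decode : B -> option A), pcancel code decode.
Proof.
move=> AB; pose code (a : A) := enum_val (widen_ord AB (enum_rank a)).
exists code, (fun b => [pick a | code a == b]) => a.
case: pickP => [a' /eqP /enum_val_inj h|/(_ a)]; last by rewrite eqxx.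
congr Some; apply: enum_rank_inj; apply: val_inj.
exact: (congr1 (fun i : 'I_#|B| => val i) h).
Qed.

(** * Deterministic machines with a random seed *)

Section DeterministicMachine.
Variables (R : realType) (n v : nat) (F Q : finType).
Variables (init : F -> Q) (stp : {set 'I_n} -> Q -> Q) (rd : bool -> Q -> Q).
Variable out : Q -> option nat.
Hypotheses (F_gt0 : (0 < #|F|)%N) (Qv : (#|Q| <= 2 ^ v)%N).

(** All randomness is drawn in the initial state. The distribution stays the image of the uniform
    one on seeds, so probabilities become counts of seeds. *)
Lemma deterministic_verifier : exists V : verifier R n,
  [/\ vspace V = v, wf_verifier V &
   forall sigma w (P : pred (option nat)), prob_out V sigma w P =
     #|[set r | P (out (foldl (fun q b => rd b q)
        (foldl (fun q e => stp e q) (init r) sigma) w))]|%:R / #|F|%:R].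
Proof.
have [|code [decode codeK]] := @card_leq_cancel Q 'I_(2 ^ v); first by rewrite card_ord.
pose lift (f : Q -> Q) (x : 'I_(2 ^ v)) : {ffun 'I_(2 ^ v) -> R} :=
  dirac R (if decode x is Some q then code (f q) else x).
pose mu : R := #|F|%:R^-1.
pose unif (h : F -> Q) : {ffun 'I_(2 ^ v) -> R} := [ffun y => \sum_r mu * dirac R (code (h r)) y].
have F0 : (#|F|%:R : R) != 0 by rewrite pnatr_eq0 -lt0n.
have unif_dist h : is_dist (unif h).
  split=> [y|]; first by rewrite ffunE sumr_ge0 // => r _; rewrite ffunE mulr_ge0 // invr_ge0.
  under eq_bigr do rewrite ffunE.
  rewrite exchange_big /=; under eq_bigr => r _.
    by rewrite -mulr_sumr (dirac_is_dist R (code (h r))).2 mulr1; over.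
  by rewrite sumr_const cardT -cardE -mulr_natr mulVf.
have push_unif h f : push (unif h) (lift f) = unif (f \o h).
  apply/ffunP => y; rewrite !ffunE; under eq_bigr do rewrite ffunE big_distrl /=.
  rewrite exchange_big /=; apply: eq_bigr => r _.
  rewrite (bigD1 (code (h r))) //= big1 ?addr0 => [|x xr].
    by rewrite /lift codeK !ffunE eqxx mulr1.
  by rewrite ffunE eq_sym (negPf xr) mulr0 mul0r.
pose V := @Verifier R n v (unif init) (fun e => lift (stp e)) (fun b => lift (rd b))
  (fun x => if decode x is Some q then out q else None).
exists V; split=> //.
  split; [exact: unif_dist|split=> [e|b0] x; exact: dirac_is_dist].
move=> sigma w P; rewrite /prob_out /run /=.
have runE (I : Type) (g : I -> Q -> Q) (l : seq I) h :
    foldl (fun d i => push d (lift (g i))) (unif h) l =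
    unif (fun r => foldl (fun q i => g i q) (h r) l).
  by elim: l h => //= i l IH h; rewrite push_unif IH.
rewrite !runE; set h1 := fun r => foldl _ (foldl _ _ _) w.
under eq_bigr do rewrite ffunE.
rewrite exchange_big /= -sum1_card natr_sum big_distrl /= [RHS]big_mkcond /=.
apply: eq_bigr => r _; rewrite inE -mulr_sumr big_mkcond /=.
rewrite (bigD1 (code (h1 r))) //= big1 ?addr0 => [|x xr].
  by rewrite codeK ffunE eqxx; case: ifP; rewrite ?mulr0 // mulr1 mul1r.
by rewrite ffunE eq_sym (negPf xr); case: ifP.
Qed.

End DeterministicMachine.

(** * Reading symbols bit by bit *)

Section BlockMachine.
Variables (Q Sym : finType) (b : nat) (rd : Sym -> Q -> Q).
Variables (code : Sym -> b.-tuple bool) (decode : b.-tuple bool -> option Sym).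
Hypotheses (b_gt0 : (0 < b)%N) (codeK : pcancel code decode).

(** Bits are buffered until a word of length [b] is complete; a word that codes no symbol is
    skipped. *)
Definition read_bit (x : bool) (qb : Q * {bseq b of bool}) : Q * {bseq b of bool} :=
  let buf := rcons qb.2 x in
  if insub buf is Some tup then
    (if decode tup is Some a then rd a qb.1 else qb.1, [bseq])
  else (qb.1, insub_bseq b buf).

(** For soundness: any bit string acts as a list of symbols that is the same for all states, hence
    for all seeds. *)
Lemma read_bits_symbols (w : seq bool) (buf : {bseq b of bool}) :
  exists l : seq Sym, forall q,
    (foldl (fun q x => read_bit x q) (q, buf) w).1 = foldl (fun q a => rd a q) q l.
Proof.
elim: w buf => [|x w IH] buf; first by exists [::].
rewrite /= /read_bit /=; case: insubP => [tup _ _|_].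
  have [l lP] := IH [bseq]; case: (decode tup) => [a|]; last by exists l.
  by exists (a :: l) => q; rewrite lP.
exact: IH.
Qed.

Lemma read_bits_code (a : Sym) q :
  foldl (fun q x => read_bit x q) (q, [bseq]) (code a) = (rd a q, [bseq]).
Proof.
have step (u w : seq bool) (buf : {bseq b of bool}) : u ++ w = code a -> w != [::] -> buf = u :> seq bool ->
    foldl (fun q x => read_bit x q) (q, buf) w = (rd a q, [bseq]).
  elim: w u buf => // x w IH u buf uw _ bufu /=.
  have sz : (size u + (size w).+1 = b)%N.
    by have := congr1 size uw; rewrite size_cat size_tuple.
  rewrite /read_bit /= bufu; case: w IH uw sz => [|y w] IH uw sz.
    rewrite -cats1 uw valK codeK //.
  rewrite /= in sz; rewrite insubN; last by rewrite size_rcons; apply/eqP; lia.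
  apply: (IH (rcons u x)) => //; first by rewrite cat_rcons.
  by rewrite val_insubd size_rcons; case: ifP => //; lia.
apply: (step [::]) => //; rewrite -size_eq0 size_tuple; lia.
Qed.

Lemma read_bits_codes (l : seq Sym) q :
  foldl (fun q x => read_bit x q) (q, [bseq]) (flatten [seq val (code a) | a <- l]) =
  (foldl (fun q a => rd a q) q l, [bseq]).
Proof. by elim: l q => //= a l IH q; rewrite foldl_cat read_bits_code IH. Qed.

End BlockMachine.

(* States of the ideal machine are unbounded; the verifier stores their image under
   the partial injection [enc] and rejects for good once it leaves the domain of [enc]. *)
Section SchemeOfMachine.
Variables (R : realType) (n v b L : nat) (F Q Sym : finType) (X : Type).
Variables (init : F -> X) (stp : {set 'I_n} -> X -> X) (rd : Sym -> X -> X).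
Variables (out : X -> option nat) (enc : X -> option Q) (dec : Q -> X).
Variable f : seq {set 'I_n} -> nat.
Hypothesis encK : forall x q, enc x = Some q -> dec q = x.
Hypotheses (F_gt0 : (0 < #|F|)%N) (b_gt0 : (0 < b)%N) (Symb : (#|Sym| <= 2 ^ b)%N).
Hypothesis Qv : ((#|Q|.+1) * 2 ^ b.+1 <= 2 ^ v)%N.

Let final r sigma l :=
  foldl (fun x a => rd a x) (foldl (fun x e => stp e x) (init r) sigma) l.

Hypothesis sound : forall sigma l, valid_stream sigma ->
  (3 * #|[set r | (enc (final r sigma l) != None) &&
     (out (final r sigma l) \notin [:: None; Some (f sigma)])]| <= #|F|)%N.
Hypothesis complete : forall sigma, valid_stream sigma ->
  exists2 l, (size l <= L)%N & forall r,
    [/\ forall k, enc (final r (take k sigma) [::]) != None,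
        forall k, enc (final r sigma (take k l)) != None
      & out (final r sigma l) = Some (f sigma)].

Let cap (g : X -> X) (q : option Q) : option Q := obind (fun q => enc (g (dec q))) q.

Let capP (I : Type) (g : I -> X -> X) (l : seq I) x :
  foldl (fun q i => cap (g i) q) (enc x) l != None ->
  foldl (fun q i => cap (g i) q) (enc x) l = enc (foldl (fun x i => g i x) x l).
Proof.
elim: l x => //= i l IH x; case xq: (enc x) => [q|] /=; last by move/eqP; case; elim: l {IH}.
by rewrite (encK xq); apply: IH.
Qed.

Let cap_total (I : Type) (g : I -> X -> X) (l : seq I) x :
  (forall k, enc (foldl (fun x i => g i x) x (take k l)) != None) ->
  foldl (fun q i => cap (g i) q) (enc x) l = enc (foldl (fun x i => g i x) x l).
Proof.
elim: l x => //= i l IH x h.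
have := h 0%N; rewrite /=; case xq: (enc x) => [q|] //= _.
by rewrite (encK xq); apply: IH => k; apply: (h k.+1).
Qed.

Lemma scheme_of_machine : exists (V : verifier R n) (prover : seq {set 'I_n} -> seq bool),
  is_scheme f V prover (L * b) /\ vspace V = v.
Proof.
have [|code [decode codeK]] := @card_leq_cancel Sym (b.-tuple bool).
  by rewrite card_tuple card_bool.
pose Q' := (option Q * {bseq b of bool})%type.
have Q'v : (#|{: Q'}| <= 2 ^ v)%N.
  apply: leq_trans Qv; rewrite card_prod card_option leq_mul2l; apply/orP; right.
  rewrite card_bseq card_bool; elim: b.+1 => [|k IHk]; first by rewrite big_ord0.
  by rewrite big_ord_recr /= expnS mul2n -addnn leq_add2r.
pose init' r : Q' := (enc (init r), [bseq]).
pose stp' e (q : Q') : Q' := (cap (stp e) q.1, q.2).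
pose rd' := read_bit (fun a => cap (rd a)) decode.
pose out' (q : Q') := obind (fun q => out (dec q)) q.1.
have [V [Vv Vwf VP]] := @deterministic_verifier R n v F Q' init' stp' rd' out' F_gt0 Q'v.
have strm r sigma : foldl (fun q e => stp' e q) (init' r) sigma =
    (foldl (fun q e => cap (stp e) q) (enc (init r)) sigma, [bseq]).
  by rewrite /init'; elim: sigma (enc (init r)) => //= e sigma IH o; rewrite IH.
have F0 : (0 : R) < #|F|%:R by rewrite ltr0n.
(* This is a boolean so that [xchoose] can turn the existence of a help string into a prover
   function; on invalid streams any string serves. *)
pose good sigma (w : seq bool) := (size w <= L * b)%N && [forall r,
  out' (foldl (fun q x => rd' x q) (foldl (fun q e => stp' e q) (init' r) sigma) w) == Some (f sigma)].
have help sigma : exists w, valid_stream sigma ==> good sigma w.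
  have [sv|_] := boolP (valid_stream sigma); last by exists [::].
  have [l lL lP] := complete sv; exists (flatten [seq val (code a) | a <- l]).
  apply/andP; split.
    apply: leq_trans (_ : size l * b <= _)%N; last by rewrite leq_mul2r lL orbT.
    rewrite size_flatten /shape -map_comp sumnE big_map (eq_bigr (fun=> b)) => [|a _].
      by rewrite big_const_seq count_predT iter_addn_0 mulnC.
    exact: size_tuple.
  apply/forallP => r; have [h1 h2 h3] := lP r.
  rewrite strm cap_total // /rd' read_bits_codes // cap_total // /out' /=.
  have := h2 (size l); rewrite take_size -/(final r sigma l).
  by case E: (enc _) => [q|] //= _; rewrite (encK E) h3.
exists V, (fun sigma => xchoose (help sigma)); split=> //; split=> //.
have goodP sigma : valid_stream sigma -> good sigma (xchoose (help sigma)).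
  by move=> sv; have /implyP := xchooseP (help sigma); apply.
split=> [sigma /goodP/andP[]//|]; split=> sigma.
  move=> /goodP/andP[_ /forallP outP]; rewrite VP.
  rewrite [X in X%:R / _](_ : _ = #|F|) ?divff ?gt_eqF //.
  by apply: eq_card => r; rewrite !inE; apply: outP.
move=> w sv; rewrite VP ler_pdivrMr //.
have [l lP] := read_bits_symbols (fun a => cap (rd a)) decode w [bseq].
have := sound l sv; rewrite -(ler_nat R) natrM => le.
rewrite -ler_pdivlMl // in le; apply: le_trans le; rewrite ler_nat.
apply/subset_leq_card/subsetP => r; rewrite !inE strm /out' lP.
set o := foldl _ _ l => /andP[of_ oN].
(* An output other than reject shows that the run never left the domain of [enc], so it agrees with
   the ideal run and [sound] applies. *)
have oN' : o != None by case: (o) oN.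
have oE : o = enc (final r sigma l).
  have sN : foldl (fun q e => cap (stp e) q) (enc (init r)) sigma != None.
    apply: contraNneq oN'; rewrite /o => ->; by elim: (l).
  by rewrite /o (capP sN) capP // -(capP sN).
rewrite -oE oN' /=; move: of_ oN; rewrite oE.
case E: (enc _) => [q|] //=; rewrite (encK E) => h1 h2.
by rewrite negb_or h1 h2.
Qed.
End SchemeOfMachine.

(** * Upper bound *)

Section Fingerprints.
Variables (n t s : nat).
Hypotheses (t_gt0 : (0 < t)%N) (s_gt0 : (0 < s)%N) (ts : (t * s)%N = n).
Implicit Types (sigma : seq {set 'I_n}) (e : {set 'I_n}) (M O : seq (seq 'I_n)) (K L U : seq 'I_n).

(* A vertex v is the pair (v %/ s, v %% s) of [t] x [s].  The (u, v) entry of the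
   adjacency matrix is stored in cell v %% s with exponent u t + v %/ s, that of
   the matrix it is paired with has the complementary exponent, so that the inner
   product of the two matrices is the coefficient of degree n t - 1. *)
Section Evaluation.
Variables (R : comNzRingType) (x : R).

Definition row_fp K : R := \sum_(u <- K) x ^+ (t * (n.-1 - u)).
Definition col_fp K (z : 'I_s) : R :=
  \sum_(v <- K | (v %% s)%N == z) x ^+ (t.-1 - v %/ s).
Definition edge_fp sigma (z : 'I_s) : R :=
  \sum_(e <- sigma) \sum_(p : 'I_n * 'I_n |
     [&& p.1 != p.2, [set p.1; p.2] == e & (p.2 %% s)%N == z]) x ^+ (p.1 * t + p.2 %/ s).
Definition block_fp M O (z : 'I_s) : R :=
  \sum_(K <- M | size K == 2) row_fp K * col_fp K z + \sum_(K <- O) row_fp K * col_fp K z.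
(** The last term gives 2 to each edge meeting [U], over its two orientations: 2 * 1 - 0 with one
    end in [U], 2 * 2 - 2 with both. *)
Definition cover_fp M O U (z : 'I_s) : R :=
  block_fp M O z + row_fp U * (col_fp (enum 'I_n) z *+ 2 - col_fp U z).
Definition product_fp sigma M O U : R :=
  \sum_z edge_fp sigma z * cover_fp M O U z.

End Evaluation.

Section Morphism.
Variables (R R' : comNzRingType) (phi : {rmorphism R -> R'}) (x : R).

Lemma rmorph_row_fp K : phi (row_fp x K) = row_fp (phi x) K.
Proof. by rewrite rmorph_sum; apply: eq_bigr => u _; rewrite rmorphXn. Qed.

Lemma rmorph_col_fp K z : phi (col_fp x K z) = col_fp (phi x) K z.
Proof. by rewrite rmorph_sum; apply: eq_bigr => u _; rewrite rmorphXn. Qed.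

(** For evaluation at r, this identifies the value of the honest polynomial with what is computed
    from the stream at the point r. *)
Lemma rmorph_product_fp sigma M O U :
  phi (product_fp x sigma M O U) = product_fp (phi x) sigma M O U.
Proof.
rewrite rmorph_sum; apply: eq_bigr => z _; rewrite rmorphM; congr (_ * _).
  rewrite rmorph_sum; apply: eq_bigr => e _; rewrite rmorph_sum.
  by apply: eq_bigr => p _; rewrite rmorphXn.
rewrite rmorphD rmorphM rmorph_row_fp rmorphB rmorphMn /= !rmorph_col_fp.
congr (_ + _); rewrite rmorphD !rmorph_sum; congr (_ + _);
  by apply: eq_bigr => K _; rewrite rmorphM rmorph_row_fp rmorph_col_fp.
Qed.

End Morphism.

Section Coefficients.
Variable F : fieldType.
Local Notation X := ('X : {poly F}).

Lemma size_sum_leq (I : Type) (r : seq I) (P : pred I) (G : I -> {poly F}) d :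
  (forall i, P i -> (size (G i) <= d)%N) -> (size (\sum_(i <- r | P i) G i)%R <= d)%N.
Proof.
move=> h; apply: (big_ind (fun p : {poly F} => (size p <= d)%N)) => //.
  by rewrite size_poly0.
by move=> p q pd qd; apply: leq_trans (size_polyD _ _) _; rewrite geq_max pd.
Qed.

Lemma size_row_fp K : (size (row_fp X K) <= (t * n.-1).+1)%N.
Proof.
by apply: size_sum_leq => u _; rewrite size_polyXn ltnS leq_mul2l leq_subr orbT.
Qed.

Lemma size_col_fp K z : (size (col_fp X K z) <= t)%N.
Proof. by apply: size_sum_leq => v _; rewrite size_polyXn (leq_ltn_trans (leq_subr _ _)) // ltn_predL. Qed.

Lemma row_ltn (v : 'I_n) : (v %/ s < t)%N.
Proof. by rewrite ltn_divLR // ts. Qed.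

Lemma size_edge_fp sigma z : (size (edge_fp X sigma z) <= n * t)%N.
Proof.
apply: size_sum_leq => e _; apply: size_sum_leq => p _; rewrite size_polyXn.
apply: (@leq_trans (p.1.+1 * t)); last by rewrite leq_mul2r ltn_ord orbT.
by rewrite mulSnr ltn_add2l row_ltn.
Qed.

Lemma degree_split : (0 < n)%N -> ((t * n.-1).+1 + t).-1 = (n * t)%N.
Proof. by case: (n) => // m _; rewrite mulSn mulnC addSn /= addnC. Qed.

Lemma size_row_col_fp K L z : (0 < n)%N -> (size (row_fp X K * col_fp X L z)%R <= n * t)%N.
Proof.
move=> n_gt0; apply: leq_trans (size_polyMleq _ _) _.
rewrite -degree_split //.
by have := leq_add (size_row_fp K) (size_col_fp L z); case: (_ + _)%N.
Qed.

Lemma size_product_fp sigma M O U : (0 < n)%N -> (size (product_fp X sigma M O U) <= 2 * n * t)%N.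
Proof.
move=> n_gt0; apply: size_sum_leq => z _; apply: leq_trans (size_polyMleq _ _) _.
have szC : (size (cover_fp X M O U z) <= n * t)%N.
  rewrite /cover_fp /block_fp mulrBr mulrnAr.
  have sumP (r : seq (seq 'I_n)) (P : pred (seq 'I_n)) :
      (size (\sum_(K <- r | P K) row_fp X K * col_fp X K z)%R <= n * t)%N.
    by apply: size_sum_leq => K _; apply: size_row_col_fp.
  rewrite (leq_trans (size_polyD _ _)) // geq_max (leq_trans (size_polyD _ _)) //=; last first.
    by rewrite geq_max !sumP.
  rewrite (leq_trans (size_polyD _ _)) // geq_max size_polyN mulr2n.
  by rewrite (leq_trans (size_polyD _ _)) ?geq_max ?size_row_col_fp.
by have := leq_add (size_edge_fp sigma z) szC; rewrite -mulnA mul2n -addnn; case: (_ + _)%N => // k /ltnW.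
Qed.

(** Distinct vertices have distinct exponents, so [row_fp] doubles as a fingerprint of the multiset
    of listed vertices. *)
Lemma coef_row_fp K (u : 'I_n) : (row_fp X K)`_(t * (n.-1 - u)) = (count_mem u K)%:R.
Proof.
rewrite coef_sum -sum1_count natr_sum [RHS]big_mkcond /=; apply: eq_bigr => v _.
rewrite coefXn eqn_pmul2l //.
have -> : (n.-1 - u == n.-1 - v)%N = (v == u).
  by rewrite -(inj_eq val_inj) /=; apply/eqP/eqP; move: (ltn_ord u) (ltn_ord v); clear; lia.
by case: (v == u).
Qed.

(** The exponents attached to (u', v') in the two matrices add up to nt - 1, so the equation says
    that u t + v/s and u' t + v'/s agree. Their base-t digits agree, and the common cell recovers
    v. *)
Lemma exponent_match (u u' v v' : 'I_n) : (v %% s)%N = (v' %% s)%N ->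
  ((u * t + v %/ s + (t * (n.-1 - u') + (t.-1 - v' %/ s)))%N == (n * t).-1) =
  (u' == u) && (v' == v).
Proof.
move=> vv'; have y := row_ltn v; have y' := row_ltn v'.
have comp : (t * (n.-1 - u') + (t.-1 - v' %/ s) + (u' * t + v' %/ s) = (n * t).-1)%N.
  have nE : n = (n.-1 - u' + u').+1 by have := ltn_ord u'; lia.
  rewrite [in RHS]nE; move: (n.-1 - u')%N (nat_of_ord u') (v' %/ s)%N y' => a c d dt.
  by rewrite mulSn mulnDl mulnC; lia.
rewrite -comp [LHS](_ : _ = (u * t + v %/ s == u' * t + v' %/ s)%N); last first.
  by rewrite addnC eqn_add2l.
apply/eqP/andP => [h|[/eqP -> /eqP -> //]].
have uu : u = u' :> nat.
  by have := congr1 (fun k => k %/ t)%N h; rewrite !divnMDl // (divn_small y) (divn_small y') !addn0.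
have yy : (v %/ s = v' %/ s)%N by move: h; rewrite uu => /addnI.
split; apply/eqP/val_inj => //=.
by rewrite (divn_eq v s) (divn_eq v' s) yy vv'.
Qed.

Definition pairs_hit K L e : nat :=
  \sum_(p : 'I_n * 'I_n | (p.1 != p.2) && ([set p.1; p.2] == e)) count_mem p.1 K * count_mem p.2 L.

Lemma coef_edge_row_col sigma K L :
  (\sum_z edge_fp X sigma z * (row_fp X K * col_fp X L z))`_(n * t).-1 =
  (\sum_(e <- sigma) pairs_hit K L e)%:R.
Proof.
have -> : \sum_z edge_fp X sigma z * (row_fp X K * col_fp X L z) =
  \sum_(e <- sigma) \sum_(p : 'I_n * 'I_n | (p.1 != p.2) && ([set p.1; p.2] == e))
    X ^+ (p.1 * t + p.2 %/ s) * (row_fp X K * col_fp X L (Ordinal (ltn_pmod p.2 s_gt0))).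
  under eq_bigr do rewrite big_distrl /=.
  rewrite exchange_big /=; apply: eq_bigr => e _.
  under eq_bigr do rewrite big_distrl /=.
  rewrite (exchange_big_dep (fun p : 'I_n * 'I_n => (p.1 != p.2) && ([set p.1; p.2] == e))) /=.
    apply: eq_bigr => p pe; rewrite (big_pred1 (Ordinal (ltn_pmod p.2 s_gt0))) // => z /=.
    by rewrite andbA pe /= -(inj_eq val_inj) eq_sym.
  by move=> z p _ /and3P[-> ->].
rewrite coef_sum natr_sum; apply: eq_bigr => e _.
rewrite coef_sum natr_sum; apply: eq_bigr => p _.
rewrite big_distrlr big_distrr coef_sum natrM -!sum1_count !natr_sum big_distrl /= big_mkcond /=.
rewrite [RHS]big_mkcond; apply: eq_bigr => u _.
rewrite big_distrr coef_sum /=.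
transitivity (\sum_(v <- L) if (u == p.1) && (v == p.2) then 1 else 0 : F); last first.
  case: (u == p.1) => /=; last by rewrite big1.
  by rewrite mul1r [RHS]big_mkcond.
rewrite big_mkcond; apply: eq_bigr => v _ /=.
case: eqP => [vz|vz]; last first.
  by case: (v =P p.2) vz => [-> []|]; rewrite ?andbF.
rewrite -!exprD coefXn eq_sym exponent_match //.
by case: (_ && _).
Qed.

Lemma coef_product_fp sigma M O U :
  (product_fp X sigma M O U)`_(n * t).-1 =
  (\sum_(e <- sigma) (\sum_(K <- M | size K == 2) pairs_hit K K e + \sum_(K <- O) pairs_hit K K e
     + (pairs_hit U (enum 'I_n) e).*2))%:R - (\sum_(e <- sigma) pairs_hit U U e)%:R.
Proof.
have -> : product_fp X sigma M O U =
    \sum_(K <- M | size K == 2) \sum_z edge_fp X sigma z * (row_fp X K * col_fp X K z) +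
    \sum_(K <- O) \sum_z edge_fp X sigma z * (row_fp X K * col_fp X K z) +
    (\sum_z edge_fp X sigma z * (row_fp X U * col_fp X (enum 'I_n) z)) *+ 2 -
    \sum_z edge_fp X sigma z * (row_fp X U * col_fp X U z).
  rewrite exchange_big /= [X in _ + X + _ - _]exchange_big /= -sumrMnl -!big_split -sumrB /=.
  apply: eq_bigr => z _; rewrite -!mulr_sumr /cover_fp /block_fp.
  by ring.
rewrite coefB coefD coefD coefMn coef_edge_row_col; congr (_ - _); last first.
  by rewrite coef_edge_row_col.
rewrite !coef_sum (eq_bigr _ (fun K _ => coef_edge_row_col sigma K K)).
rewrite [X in _ + X + _](eq_bigr _ (fun K _ => coef_edge_row_col sigma K K)).
rewrite -!natr_sum -mulrnA -!natrD; congr _%:R.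
rewrite !big_split /=; congr (_ + _ + _)%N; [exact: exchange_big | exact: exchange_big |].
by rewrite big_distrl; apply: eq_bigr => e _; rewrite /= muln2.
Qed.

End Coefficients.
End Fingerprints.

(** * The tested coefficient and the certificate inequality *)

Section PairsHit.
Variable n : nat.
Implicit Types (sigma : seq {set 'I_n}) (e : {set 'I_n}) (M O : seq (seq 'I_n)) (K L U : seq 'I_n).
Local Open Scope nat_scope.

Lemma pairs_hitE K L (a b : 'I_n) : a != b ->
  pairs_hit K L [set a; b] = count_mem a K * count_mem b L + count_mem b K * count_mem a L.
Proof.
move=> ab; have ba : (b, a) != (a, b) :> 'I_n * 'I_n.
  by rewrite xpair_eqE eq_sym (negPf ab).
rewrite /pairs_hit (bigD1 (a, b)) /=; last by rewrite ab eqxx.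
rewrite (bigD1 (b, a)) /=; last by rewrite eq_sym ab setUC eqxx ba.
rewrite big1 ?addn0 // => -[x y] /= /andP[/andP[/andP[xy /eqP/setP h] n1] n2].
have xe : x \in [set a; b] by rewrite -h !inE eqxx.
have ye : y \in [set a; b] by rewrite -h !inE eqxx orbT.
move: xe ye xy n1 n2; rewrite !inE !xpair_eqE.
by do 2![case/orP=> /eqP->]; rewrite ?eqxx.
Qed.

Lemma uniq_flatten_mem (T : eqType) (M : seq (seq T)) (K : seq T) : uniq (flatten M) -> K \in M -> uniq K.
Proof.
elim: M => //= L M IH; rewrite cat_uniq => /and3P[uL _ uM].
by rewrite inE => /orP[/eqP->|/IH]; [|apply].
Qed.

Lemma edge_subset (a b : 'I_n) K : ([set a; b] \subset K) = (a \in K) && (b \in K).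
Proof.
apply/subsetP/andP => [h|[aK bK] x]; first by split; apply: h; rewrite !inE eqxx ?orbT.
by rewrite !inE => /orP[]/eqP->.
Qed.

Lemma edge_meets (a b : 'I_n) U : ~~ [disjoint [set a; b] & U] = (a \in U) || (b \in U).
Proof.
apply/pred0Pn/orP => [[x /andP[]]|[h|h]].
- by rewrite !inE => /orP[]/eqP-> h; [left|right].
- by exists a; rewrite /= !inE eqxx.
- by exists b; rewrite /= !inE eqxx orbT.
Qed.

Lemma pairs_hit_block K e : uniq K -> #|e| == 2 -> pairs_hit K K e = (e \subset K).*2.
Proof.
move=> uK /cards2P[a [b [ab ->]]]; rewrite pairs_hitE // !count_uniq_mem //.
rewrite edge_subset -addnn.
by case: (a \in K); case: (b \in K).
Qed.

Lemma pairs_hit_cover U e : uniq U -> #|e| == 2 ->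
  (pairs_hit U (enum 'I_n) e).*2 = (~~ [disjoint e & U]).*2 + pairs_hit U U e.
Proof.
move=> uU e2; rewrite (pairs_hit_block uU e2).
case/cards2P: e2 => a [b [ab ->]].
rewrite pairs_hitE // !(count_uniq_mem _ (enum_uniq _)) !mem_enum !count_uniq_mem //.
rewrite edge_subset edge_meets.
by case: (a \in U); case: (b \in U).
Qed.

(** The double counts the two orientations of an edge; the permutation hypotheses make blocks and
    cover duplicate-free, so no multiplicity enters. *)
Lemma coef_certificate (F : fieldType) (t s : nat) sigma M O U :
  0 < t -> 0 < s -> t * s = n -> valid_stream sigma ->
  perm_eq (flatten M) (enum 'I_n) -> perm_eq (flatten O ++ U) (enum 'I_n) ->
  ((product_fp t s ('X : {poly F}) sigma M O U)`_(n * t).-1 =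
  (\sum_(e <- sigma) (pair_weight M e + cover_weight O U e)).*2%:R)%R.
Proof.
move=> t0 s0 ts /andP[_ /allP s2] pM pO; rewrite coef_product_fp //.
apply: (canLR (addrK _)); rewrite -natrD; congr (_%:R)%R.
have uM : uniq (flatten M) by rewrite (perm_uniq pM) enum_uniq.
have : uniq (flatten O ++ U) by rewrite (perm_uniq pO) enum_uniq.
rewrite cat_uniq => /and3P[uO _ uU].
rewrite -muln2 big_distrl -big_split /= big_seq [RHS]big_seq; apply: eq_bigr => e /s2 e2.
rewrite pairs_hit_cover // addnA; congr (_ + _).
rewrite /cover_weight mulnDl mulnDl addnA !muln2; congr (_ + _ + _).
  rewrite /pair_weight -sum1_count -muln2 big_distrl /= big_mkcondr /= big_seq_cond [RHS]big_seq_cond.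
  apply: eq_bigr => K /andP[KM _]; rewrite pairs_hit_block ?(uniq_flatten_mem uM) //.
  by case: ifP.
rewrite /blocks_over -sum1_count -muln2 big_distrl /= [RHS]big_mkcond big_seq_cond [RHS]big_seq_cond.
apply: eq_bigr => K /andP[KM _]; rewrite pairs_hit_block ?(uniq_flatten_mem uO) //.
by case: ifP.
Qed.

End PairsHit.

Lemma card_roots_leq (F : finFieldType) (p : {poly F}) (d : nat) :
  p != 0 -> (size p <= d)%N -> (#|[set r | root p r]| <= d)%N.
Proof.
move=> p0 pd; apply: leq_trans pd; rewrite cardE ltnW //.
apply: max_poly_roots => //; last exact: enum_uniq.
by apply/allP => r; rewrite mem_enum inE.
Qed.

(** Multiplicities are coefficients; a list of length at most [B] has multiplicities on which the
    map to [F] is injective, so none can pass for 1. *)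
Lemma row_fp_perm (F : fieldType) (n t B : nat) (K : seq 'I_n) : (0 < t)%N ->
  (forall a b : nat, (a <= B)%N -> (b <= B)%N -> a%:R = b%:R :> F -> a = b) ->
  (0 < B)%N -> (size K <= B)%N ->
  row_fp t ('X : {poly F}) K = row_fp t 'X (enum 'I_n) -> perm_eq K (enum 'I_n).
Proof.
move=> t0 inj B0 KB /polyP h; apply/allP => u _ /=; apply/eqP.
have := h (t * (n.-1 - u))%N; rewrite !coef_row_fp // [in RHS]count_uniq_mem ?enum_uniq //.
rewrite mem_enum => /inj -> //; last exact: leq_trans (count_size _ _) KB.
by rewrite count_uniq_mem ?enum_uniq // mem_enum.
Qed.

Lemma size_take_leq (T : Type) k (l : seq T) : (size (take k l) <= size l)%N.
Proof. by rewrite size_take_min geq_minr. Qed.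

(** * The Verifier as a streaming machine *)

Section Machine.
Variables (n t s B : nat) (F : finFieldType).
Hypotheses (t_gt0 : (0 < t)%N) (s_gt0 : (0 < s)%N) (ts : (t * s)%N = n).
Hypotheses (F_inj : forall a b : nat, (a <= B)%N -> (b <= B)%N -> a%:R = b%:R :> F -> a = b).
Hypotheses (FB : (6 * n * t <= #|F|)%N) (nB : (6 * n * t + 4 * n ^ 2 <= B)%N).
Implicit Types (sigma : seq {set 'I_n}) (M O : seq (seq 'I_n)) (K U : seq 'I_n).

Record state := State {
  st_point : F; st_row : F; st_pairs_row : F; st_blocks_row : F; st_eval : F; st_coef : F;
  st_edges : {ffun 'I_s -> F}; st_cells : {ffun 'I_s -> F}; st_col : {ffun 'I_s -> F};
  st_size : nat; st_seen : nat; st_pairs : nat; st_cover : nat; st_stream : nat }.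

Record transcript := Transcript {
  tr_open : seq 'I_n; tr_pairs : seq (seq 'I_n); tr_blocks : seq (seq 'I_n); tr_poly : {poly F} }.

(* inl (inr b) closes the open block, as a block of the matching (b = true) or of the
   cover (b = false). *)
Definition symbol : finType := (('I_n + bool) + ('I_(2 * n * t) * F))%type.

Definition announce (a : symbol) (T : transcript) : transcript :=
  let: Transcript K M J P := T in
  match a with
  | inl (inl u) => Transcript (u :: K) M J P
  | inl (inr true) => Transcript [::] (K :: M) J P
  | inl (inr false) => Transcript [::] M (K :: J) P
  | inr (j, y) => Transcript K M J (P + y *: 'X^j)
  end.

(** The intended state as a function of everything received. Since the updates commute with it,
    soundness and completeness are argued on lists and polynomials. *)
Definition snapshot (r : F) sigma (T : transcript) : state :=
  let: Transcript K M J P := T in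
  State r (row_fp t r K) (row_fp t r (flatten M)) (row_fp t r (flatten J)) P.[r] P`_(n * t).-1
    [ffun z => edge_fp t r sigma z] [ffun z => block_fp t r M J z] [ffun z => col_fp t r K z]
    (size K) (size K + size (flatten M) + size (flatten J)) (pair_count M)
    (\sum_(L <- J) (size L)./2) (size sigma).

Definition read_edge (e : {set 'I_n}) (x : state) : state :=
  let: State r a FM FO P D E C b c N kM kO m := x in
  State r a FM FO P D [ffun z => E z + edge_fp t r [:: e] z] C b c N kM kO m.+1.

Definition read_symbol (g : symbol) (x : state) : state :=
  let: State r a FM FO P D E C b c N kM kO m := x in
  match g with
  | inl (inl u) => State r (row_fp t r [:: u] + a) FM FO P D E C
      [ffun z => col_fp t r [:: u] z + b z] c.+1 N.+1 kM kO m
  | inl (inr true) => State r 0 (a + FM) FO P D E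
      [ffun z => (if c == 2 then a * b z else 0) + C z] [ffun=> 0] 0 N ((c == 2) + kM) kO m
  | inl (inr false) => State r 0 FM (a + FO) P D E
      [ffun z => a * b z + C z] [ffun=> 0] 0 N kM (c./2 + kO) m
  | inr (j, y) => State r a FM FO (P + y * r ^+ j) (D + y * ((n * t).-1 == j)%:R) E C b c N kM kO m
  end.

(* The block left open at the end of the help is the vertex cover part of the certificate. *)
Definition verdict (x : state) : option nat :=
  let: State r a FM FO P D E C b c N kM kO m := x in
  if [&& FM == row_fp t r (enum 'I_n), FO + a == row_fp t r (enum 'I_n),
         P == \sum_z E z * (C z + a * (col_fp t r (enum 'I_n) z *+ 2 - b z)),
         D == (m + kM).*2%:R & kM == (kO + c)%N]
  then Some kM else None.

Lemma read_edge_snapshot e r sigma T :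
  read_edge e (snapshot r sigma T) = snapshot r (rcons sigma e) T.
Proof.
case: T => K M O P /=; rewrite size_rcons; congr State.
by apply/ffunP => z; rewrite !ffunE /edge_fp -cats1 big_cat.
Qed.

Lemma read_symbol_snapshot g r sigma T :
  read_symbol g (snapshot r sigma T) = snapshot r sigma (announce g T).
Proof.
case: T => K M O P; case: g => [[u|[]]|[j y]] /=; congr State; rewrite ?ffunE //.
- by rewrite /row_fp !big_cons big_nil addr0.
- apply/ffunP => z; rewrite !ffunE /col_fp !big_cons big_nil.
  by case: ifP; rewrite ?addr0 ?add0r.
- by rewrite /row_fp big_nil.
- by rewrite /row_fp big_cat.
- by apply/ffunP => z; rewrite !ffunE /block_fp big_cons; case: ifP; rewrite ?add0r ?addrA.
- by apply/ffunP => z; rewrite !ffunE /col_fp big_nil.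
- by rewrite size_cat; clear; lia.
- by rewrite /row_fp big_nil.
- by rewrite /row_fp big_cat.
- by apply/ffunP => z; rewrite !ffunE /block_fp big_cons addrCA.
- by apply/ffunP => z; rewrite !ffunE /col_fp big_nil.
- by rewrite size_cat; clear; lia.
- by rewrite big_cons.
- by rewrite hornerD hornerZ hornerXn.
- by rewrite coefD coefZ coefXn.
Qed.

Definition no_help := Transcript [::] [::] [::] 0.
Definition start (r : F) := snapshot r [::] no_help.
Definition transcript_of (l : seq symbol) := foldl (fun T g => announce g T) no_help l.
Definition final r sigma (l : seq symbol) :=
  foldl (fun x g => read_symbol g x) (foldl (fun x e => read_edge e x) (start r) sigma) l.

Lemma final_snapshot r sigma l : final r sigma l = snapshot r sigma (transcript_of l).
Proof.
rewrite /final; have -> : foldl (fun x e => read_edge e x) (start r) sigma = snapshot r sigma no_help.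
  elim/last_ind: sigma => // sigma e IH.
  by rewrite foldl_rcons IH read_edge_snapshot.
rewrite /transcript_of; elim: l no_help => //= g l IH T.
by rewrite read_symbol_snapshot IH.
Qed.

Definition packed : finType :=
  ((F * F * F * F * F * F) * ({ffun 'I_s -> F} * {ffun 'I_s -> F} * {ffun 'I_s -> F}) *
   ('I_B.+1 * 'I_B.+1 * 'I_B.+1 * 'I_B.+1 * 'I_B.+1))%type.

Definition pack (x : state) : option packed :=
  let: State r a FM FO P D E C b c N kM kO m := x in
  if [&& c <= B, N <= B, kM <= B, kO <= B & m <= B]%N
  then Some ((r, a, FM, FO, P, D), (E, C, b), (inord c, inord N, inord kM, inord kO, inord m))
  else None.

Definition unpack (q : packed) : state :=
  let: ((r, a, FM, FO, P, D), (E, C, b), (c, N, kM, kO, m)) := q in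
  State r a FM FO P D E C b c N kM kO m.

Lemma packK x q : pack x = Some q -> unpack q = x.
Proof.
case: x => r a FM FO P D E C b c N kM kO m /=.
by case: ifP => // /and5P[? ? ? ? ?] [<-] /=; rewrite !inordK.
Qed.

Lemma card_packed : #|packed| = (#|F| ^ 6 * #|F| ^ (3 * s) * B.+1 ^ 5)%N.
Proof.
rewrite !card_prod !card_ffun !card_ord; congr (_ * _ * _)%N.
- by rewrite !expnS expn0 muln1 !mulnA.
- by rewrite -!expnD; congr (_ ^ _)%N; clear; lia.
- by rewrite !expnS expn0 muln1 !mulnA.
Qed.

(** Every counter is controlled by the number of items read, so honest runs never overflow
    [pack]. *)
Definition light (i : nat) (x : state) : bool :=
  (st_size x + st_pairs x + st_cover x <= st_seen x <= i)%N && (st_stream x <= i)%N.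

Lemma light_symbol i g x : light i x -> light i.+1 (read_symbol g x).
Proof.
case: x => r a FM FO P D E C b c N kM kO m; rewrite /light /=.
by case: g => [[u|[]]|[j y]] /= /andP[/andP[h1 h2] h3]; clear -h1 h2 h3; lia.
Qed.

Lemma light_edge i e x : light i x -> light i.+1 (read_edge e x).
Proof.
case: x => r a FM FO P D E C b c N kM kO m; rewrite /light /=.
by move=> /andP[/andP[h1 h2] h3]; clear -h1 h2 h3; lia.
Qed.

Lemma light_final r sigma l : light (size sigma + size l) (final r sigma l).
Proof.
have h : light (size sigma) (foldl (fun x e => read_edge e x) (start r) sigma).
  elim/last_ind: sigma => [|sigma e IH]; first by rewrite /light /= big_nil.
  by rewrite foldl_rcons size_rcons light_edge.
rewrite /final; elim/last_ind: l => [|l g IH]; first by rewrite addn0.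
by rewrite foldl_rcons size_rcons addnS light_symbol.
Qed.

Lemma pack_light i x : (i <= B)%N -> light i x -> pack x != None.
Proof.
case: x => r a FM FO P D E C b c N kM kO m iB; rewrite /light /= => /andP[/andP[h1 h2] h3].
by clear -iB h1 h2 h3; rewrite ifT //; apply/and5P; split; lia.
Qed.

Lemma stream_size_leq sigma : valid_stream sigma -> (size sigma <= n ^ 2)%N.
Proof.
case/andP=> us /allP s2.
apply: (@leq_trans #|[set A : {set 'I_n} | #|A| == 2]|).
  rewrite -(card_uniqP us); apply/subset_leq_card/subsetP => e /s2.
  by rewrite inE.
by rewrite card_draws card_ord bin2 -divn2 (leq_trans (leq_div _ _)) // -mulnn leq_mul2l leq_pred orbT.
Qed.

Let n_gt0 : (0 < n)%N. Proof. by rewrite -ts muln_gt0 t_gt0. Qed.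

(** The exponents sent lie in ['I_(2 * n * t)], so the degree bound holds for a dishonest Prover
    too. *)
Lemma size_transcript_poly l : (size (tr_poly (transcript_of l)) <= 2 * n * t)%N.
Proof.
rewrite /transcript_of; have : (size (tr_poly no_help) <= 2 * n * t)%N by rewrite size_poly0.
elim: l no_help => //= g l IH T hT; apply: IH.
case: T g hT => K M O P [[u|[]]|[j y]] //= hP.
apply: leq_trans (size_polyD _ _) _; rewrite geq_max hP /=.
by apply: leq_trans (size_scale_leq _ _) _; rewrite size_polyXn.
Qed.

Lemma horner_row_fp r K : (row_fp t ('X : {poly F}) K).[r] = row_fp t r K.
Proof. by rewrite -horner_evalE rmorph_row_fp /= horner_evalE hornerX. Qed.

Lemma horner_product_fp r sigma M O U :
  (product_fp t s ('X : {poly F}) sigma M O U).[r] = product_fp t s r sigma M O U.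
Proof. by rewrite -horner_evalE rmorph_product_fp /= horner_evalE hornerX. Qed.

Lemma size_row_fp_leq K : (size (row_fp t ('X : {poly F}) K) <= 2 * n * t)%N.
Proof.
apply: leq_trans; first exact: size_row_fp.
apply: (@leq_trans (n * t)); last by rewrite -mulnA leq_pmull.
by rewrite -[X in (_ < X * _)%N](prednK n_gt0) mulSn mulnC -[X in (X < _)%N]add0n ltn_add2r.
Qed.

Lemma verdict_snapshot r sigma K M O P : verdict (snapshot r sigma (Transcript K M O P)) =
  let kM := pair_count M in
  if [&& row_fp t r (flatten M) == row_fp t r (enum 'I_n),
         row_fp t r (flatten O ++ K) == row_fp t r (enum 'I_n),
         P.[r] == product_fp t s r sigma M O K,
         P`_(n * t).-1 == (size sigma + kM).*2%:R
       & kM == (\sum_(L <- O) (size L)./2 + size K)%N]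
  then Some kM else None.
Proof.
rewrite /=; congr (if [&& _, _, _, _ & _] then _ else _).
  by rewrite /row_fp big_cat.
by congr (_ == _); apply: eq_bigr => z _; rewrite !ffunE.
Qed.

Lemma natr_double_inj (a b : nat) : (a.*2 <= B)%N -> (b.*2 <= B)%N ->
  a.*2%:R = b.*2%:R :> F -> a = b.
Proof. by move=> aB bB /F_inj => /(_ aB bB) /double_inj. Qed.

(** The transcript does not depend on r. If one of the three polynomial identities fails, it holds
    at no more than 2nt points, at most a third of [F]; if all hold, the lists form a certificate
    and the output is right. *)
Lemma transcript_sound sigma l : valid_stream sigma ->
  (3 * #|[set r | (pack (final r sigma l) != None) &&
     (verdict (final r sigma l) \notin [:: None; Some (MaxMatching sigma)])]| <= #|F|)%N.
Proof.
move=> vs; set bad := [set r | _].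
have [-> |[r0 r0bad]] := set_0Vmem bad; first by rewrite cards0.
have sP := size_transcript_poly l.
case T: (transcript_of l) sP => [K M O P] /= sP.
have badP r : r \in bad -> [/\ pack (snapshot r sigma (Transcript K M O P)) != None,
    verdict (snapshot r sigma (Transcript K M O P)) != None &
    verdict (snapshot r sigma (Transcript K M O P)) != Some (MaxMatching sigma)].
  rewrite inE final_snapshot T => /andP[h1]; rewrite !inE negb_or => /andP[h2 h3].
  by split.
have accP r : r \in bad -> [/\ row_fp t r (flatten M) = row_fp t r (enum 'I_n),
         row_fp t r (flatten O ++ K) = row_fp t r (enum 'I_n),
         P.[r] = product_fp t s r sigma M O K,
         P`_(n * t).-1 = (size sigma + pair_count M).*2%:R
       & pair_count M = (\sum_(L <- O) (size L)./2 + size K)%N].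
  move=> /badP[_ + _]; rewrite verdict_snapshot /=; case: ifP => // + _.
  by case/and5P => /eqP ? /eqP ? /eqP ? /eqP ? /eqP ?.
have few (p : {poly F}) : p != 0 -> (size p <= 2 * n * t)%N ->
    (forall r, r \in bad -> p.[r] = 0) -> (3 * #|bad| <= #|F|)%N.
  move=> p0 sp pr; apply: leq_trans _ FB; have := card_roots_leq p0 sp.
  have : (#|bad| <= #|[set r | root p r]|)%N.
    by apply/subset_leq_card/subsetP => r /pr pr0; rewrite inE /root pr0.
  move: #|bad| #|[set r | root p r]| => a b; lia.
have sub_size (p q : {poly F}) : (size p <= 2 * n * t)%N -> (size q <= 2 * n * t)%N ->
    (size (p - q)%R <= 2 * n * t)%N.
  by move=> hp hq; apply: leq_trans (size_polyD _ _) _; rewrite size_polyN geq_max hp.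
have [e1|n1] := eqVneq (row_fp t ('X : {poly F}) (flatten M)) (row_fp t 'X (enum 'I_n)); last first.
  apply: (few (row_fp t 'X (flatten M) - row_fp t 'X (enum 'I_n))).
  - by rewrite subr_eq0.
  - by apply: sub_size; apply: size_row_fp_leq.
  - by move=> r /accP[h _ _ _ _]; rewrite hornerD hornerN !horner_row_fp h subrr.
have [e2|n2] := eqVneq (row_fp t ('X : {poly F}) (flatten O ++ K)) (row_fp t 'X (enum 'I_n)); last first.
  apply: (few (row_fp t 'X (flatten O ++ K) - row_fp t 'X (enum 'I_n))).
  - by rewrite subr_eq0.
  - by apply: sub_size; apply: size_row_fp_leq.
  - by move=> r /accP[_ h _ _ _]; rewrite hornerD hornerN !horner_row_fp h subrr.
have [e3|n3] := eqVneq P (product_fp t s ('X : {poly F}) sigma M O K); last first.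
  apply: (few (P - product_fp t s 'X sigma M O K)).
  - by rewrite subr_eq0.
  - by apply: sub_size => //; apply: size_product_fp.
  - by move=> r /accP[_ _ h _ _]; rewrite hornerD hornerN horner_product_fp h subrr.
exfalso; have [packr some wrong] := badP _ r0bad; have [_ _ _ hD hk] := accP _ r0bad.
have seenB : (size K + size (flatten M) + size (flatten O) <= B)%N.
  by move: packr; rewrite /=; case: ifP => // /and5P[].
have B_gt0 : (0 < B)%N by move: nB n_gt0; rewrite -mulnn; nia.
have pM : perm_eq (flatten M) (enum 'I_n).
  apply: (row_fp_perm t_gt0 F_inj B_gt0 _ e1); move: seenB; lia.
have pO : perm_eq (flatten O ++ K) (enum 'I_n).
  apply: (row_fp_perm t_gt0 F_inj B_gt0 _ e2); rewrite size_cat; move: seenB; lia.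
have [leM leO] := sum_weights_leq vs pM pO.
have kMn : (pair_count M <= n)%N.
  rewrite hk -[X in (_ <= X)%N](size_enum_ord n) -(perm_size pO) size_cat leq_add2r.
  rewrite size_flatten /shape sumnE big_map; apply: leq_sum => L _.
  by rewrite -divn2 leq_div.
have nn2 : (n <= n ^ 2)%N by rewrite -mulnn leq_pmulr.
have n2B : ((n ^ 2 + n).*2 <= B)%N.
  by apply: leq_trans _ nB; move: (6 * n * t)%N (n ^ 2)%N nn2 => a b; lia.
(* Both sides of the coefficient test are at most [B], so their equality in [F] is an equality of
   integers. *)
have total : ((size sigma + pair_count M).*2 <= B)%N.
  by apply: leq_trans n2B; rewrite leq_double leq_add // stream_size_leq.
have total' : ((\sum_(e <- sigma) (pair_weight M e + cover_weight O K e)).*2 <= B)%N.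
  apply: leq_trans total; rewrite leq_double big_split /= addnC; exact: leq_add.
have certP : is_certificate sigma M O K.
  rewrite /is_certificate pM pO hk eqxx andbT /= -hk.
  rewrite e3 (coef_certificate _ t_gt0 s_gt0 ts vs pM pO) in hD.
  by rewrite (natr_double_inj total' total hD).
have acc : verdict (snapshot r0 sigma (Transcript K M O P)) = Some (pair_count M).
  by move: some; rewrite verdict_snapshot /=; case: ifP.
by move: wrong; rewrite acc (certificate_sound vs certP) eqxx.
Qed.

(** Lists are sent in reverse because [announce] adds at the front. *)
Definition vertex_symbols K : seq symbol := [seq inl (inl u) | u <- rev K].
Definition block_symbols (b : bool) K : seq symbol := rcons (vertex_symbols K) (inl (inr b)).
Definition poly_symbols (P : {poly F}) : seq symbol :=
  [seq inr (j, P`_(val j)) | j <- enum 'I_(2 * n * t)].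
Definition help_symbols M O U (P : {poly F}) : seq symbol :=
  flatten [seq block_symbols true K | K <- rev M] ++
  flatten [seq block_symbols false K | K <- rev O] ++ vertex_symbols U ++ poly_symbols P.

Local Notation announces := (foldl (fun T g => announce g T)).

Lemma announce_vertices K K' M O P :
  announces (Transcript K' M O P) (vertex_symbols K) = Transcript (K ++ K') M O P.
Proof.
rewrite /vertex_symbols; elim: K K' => // u K IH K'.
by rewrite rev_cons map_rcons foldl_rcons IH.
Qed.

Lemma announce_pairs M M' O P :
  announces (Transcript [::] M' O P) (flatten [seq block_symbols true K | K <- rev M]) =
  Transcript [::] (M ++ M') O P.
Proof.
elim: M => // K M IH; rewrite rev_cons map_rcons flatten_rcons foldl_cat IH.
by rewrite foldl_rcons announce_vertices cats0.
Qed.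

Lemma announce_blocks M O O' P :
  announces (Transcript [::] M O' P) (flatten [seq block_symbols false K | K <- rev O]) =
  Transcript [::] M (O ++ O') P.
Proof.
elim: O => // K O IH; rewrite rev_cons map_rcons flatten_rcons foldl_cat IH.
by rewrite foldl_rcons announce_vertices cats0.
Qed.

Lemma announce_poly K M O (P : {poly F}) : (size P <= 2 * n * t)%N ->
  announces (Transcript K M O 0) (poly_symbols P) = Transcript K M O P.
Proof.
move=> sP; have gen (js : seq 'I_(2 * n * t)) Q :
    announces (Transcript K M O Q) [seq (inr (j, P`_(val j)) : symbol) | j <- js] =
    Transcript K M O (Q + \sum_(j <- js) P`_(val j) *: 'X^(val j)).
  elim: js Q => [|j js IH] Q /=; first by rewrite big_nil addr0.
  by rewrite IH big_cons addrA.
rewrite gen add0r big_enum /= -poly_def; congr Transcript.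
apply/polyP => i; rewrite coef_poly; case: ltnP => // le.
by rewrite nth_default // (leq_trans sP).
Qed.

Lemma transcript_help M O U (P : {poly F}) : (size P <= 2 * n * t)%N ->
  transcript_of (help_symbols M O U P) = Transcript U M O P.
Proof.
move=> sP; rewrite /transcript_of /help_symbols !foldl_cat announce_pairs announce_blocks.
by rewrite announce_vertices !cats0 announce_poly.
Qed.

Lemma size_blocks b M :
  size (flatten [seq block_symbols b K | K <- rev M]) = (size (flatten M) + size M)%N.
Proof.
elim: M => // K M IH; rewrite rev_cons map_rcons flatten_rcons size_cat IH /= size_cat.
by rewrite size_rcons size_map size_rev; clear; lia.
Qed.

Lemma transcript_complete sigma : valid_stream sigma ->
  exists2 l, (size l <= 6 * n * t)%N & forall r,
    [/\ forall k, pack (final r (take k sigma) [::]) != None,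
        forall k, pack (final r sigma (take k l)) != None
      & verdict (final r sigma l) = Some (MaxMatching sigma)].
Proof.
move=> vs; have [M [O [U [cert sM sO]]]] := certificate_exists vs.
have := cert; rewrite /is_certificate => /and4P[pM pO le /eqP kE].
pose P := product_fp t s ('X : {poly F}) sigma M O U.
have sP : (size P <= 2 * n * t)%N by apply: size_product_fp.
(* There are 2n vertices, 2n block ends and 2nt coefficients, and 4n + 2nt <= 6nt. *)
have sl : (size (help_symbols M O U P) <= 6 * n * t)%N.
  have svU : size (vertex_symbols U) = size U by rewrite size_map size_rev.
  have spP : size (poly_symbols P) = (2 * n * t)%N by rewrite size_map size_enum_ord.
  rewrite /help_symbols !size_cat !size_blocks svU spP sM sO.
  rewrite (perm_size pM) size_enum_ord.
  have := perm_size pO; rewrite size_cat size_enum_ord.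
  have : (n <= n * t)%N by rewrite leq_pmulr.
  rewrite -!mulnA; move: (n * t)%N (size U) (size (flatten O)) => a b c; clear; lia.
exists (help_symbols M O U P) => // r; split=> [k|k|].
- apply: pack_light (light_final r (take k sigma) [::]).
  rewrite addn0 (leq_trans (size_take_leq _ _)) //.
  by apply: leq_trans (stream_size_leq vs) (leq_trans _ nB); rewrite -[X in (X <= _)%N]add0n leq_add // leq_pmull.
- apply: pack_light (light_final r sigma (take k _)).
  apply: leq_trans _ nB; rewrite addnC leq_add ?(leq_trans (size_take_leq _ _) sl) //.
  by rewrite (leq_trans (stream_size_leq vs)) // leq_pmull.
rewrite final_snapshot transcript_help // verdict_snapshot /=.
have row_perm K : perm_eq K (enum 'I_n) -> row_fp t r K = row_fp t r (enum 'I_n).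
  by move=> pK; apply: perm_big.
rewrite !row_perm // horner_product_fp !eqxx -kE eqxx /= andbT.
rewrite (coef_certificate _ t_gt0 s_gt0 ts vs pM pO) (certificate_sound vs cert).
rewrite ifT //; apply/eqP; congr (_.*2%:R); apply/eqP; rewrite eqn_leq le andbT.
have [leM leO] := sum_weights_leq vs pM pO.
by rewrite big_split /= addnC leq_add.
Qed.

End Machine.

(** * Choice of the field and count of the bits *)

Lemma natr_Fp_inj (p B a b : nat) : prime p -> (B < p)%N -> (a <= B)%N -> (b <= B)%N ->
  a%:R = b%:R :> 'F_p -> a = b.
Proof.
move=> pp Bp aB bB /(congr1 val) /=; rewrite !val_Fp_nat //.
by rewrite !modn_small // (leq_ltn_trans _ Bp).
Qed.

Theorem matching_scheme (R : realType) (n t s : nat) : (0 < t)%N -> (0 < s)%N -> (t * s)%N = n ->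
  exists (V : verifier R n) (prover : seq {set 'I_n} -> seq bool) (hb : nat),
    [/\ is_scheme (@MaxMatching n) V prover hb, (hb <= 200 * (n * t) * logf n)%N
      & (vspace V <= 200 * s * logf n)%N].
Proof.
move=> t0 s0 ts; set l := logf n; have l0 : (0 < l)%N by [].
have nl : (n < 2 ^ l)%N by apply: trunc_log_ltn.
have n0 : (0 < n)%N by rewrite -ts muln_gt0 t0.
have tn : (t <= n)%N by rewrite -ts leq_pmulr.
(* [B] is 16 * 2^(2l), hence at least 16 n^2, which covers 6nt + 4n^2; the prime lies between [B]
   and its square, so a field element takes 2m bits. *)
pose m := (l.*2 + 4)%N; pose B := (2 ^ m)%N.
have [|p pp /andP[Bp pB]] := @exists_prime_between m; first by rewrite /m; lia.
pose F : finFieldType := 'F_p; have cF : #|F| = p by rewrite card_Fp.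
have n2 : (n ^ 2 <= 2 ^ l.*2)%N by rewrite -muln2 expnM leq_exp2r // ltnW.
have BE : B = (16 * 2 ^ l.*2)%N by rewrite /B /m expnD mulnC.
have nt : (n * t <= n ^ 2)%N by rewrite -mulnn leq_mul2l tn orbT.
have FB : (6 * n * t <= #|F|)%N.
  by rewrite cF; apply: leq_trans (ltnW Bp); rewrite -/B BE -mulnA; lia.
have nB : (6 * n * t + 4 * n ^ 2 <= B)%N by rewrite BE -mulnA; lia.
have F_inj (a b : nat) : (a <= B)%N -> (b <= B)%N -> a%:R = b%:R :> F -> a = b.
  exact: natr_Fp_inj.
pose b := (3 * m)%N.
have Symb : (#|symbol n t F| <= 2 ^ b)%N.
  rewrite !card_sum card_bool card_prod cF !card_ord.
  have e1 : (n + 2 <= 2 ^ (l.*2 + 2) * 2 ^ m.*2)%N.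
    apply: (@leq_trans (2 ^ (l.*2 + 2))); last by rewrite leq_pmulr // expn_gt0.
    rewrite expnD; have : (n <= n ^ 2)%N by rewrite -mulnn leq_pmulr.
    have : (0 < 2 ^ l.*2)%N by rewrite expn_gt0.
    move: n2; lia.
  have e2 : (2 * n * t * p <= 2 ^ (l.*2 + 2) * 2 ^ m.*2)%N.
    by apply: leq_mul => //; rewrite expnD -mulnA; lia.
  have -> : (2 ^ b = 4 * (2 ^ (l.*2 + 2) * 2 ^ m.*2))%N.
    by rewrite -!expnD -[4%N]/(2 ^ 2)%N -expnD; congr (2 ^ _)%N; rewrite /b /m; lia.
  by move: e1 e2; lia.
(* Six field elements, five counters and three vectors of [s] field elements take 2m bits each; one
   bit pays for the overflow state and b + 1 bits for the buffer. *)
pose v := (m.*2 * (11 + 3 * s) + 1 + b.+1)%N.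
have Qv : (#|packed s B F|.+1 * 2 ^ b.+1 <= 2 ^ v)%N.
  rewrite /v expnD leq_mul2r; apply/orP; right.
  rewrite card_packed cF (expnD 2 _ 1) muln2.
  have q1 : (p ^ 6 * p ^ (3 * s) * B.+1 ^ 5 <= 2 ^ (m.*2 * (11 + 3 * s)))%N.
    have -> : (2 ^ (m.*2 * (11 + 3 * s)) =
        (2 ^ m.*2) ^ 6 * (2 ^ m.*2) ^ (3 * s) * (2 ^ m.*2) ^ 5)%N.
      by rewrite -!(expnM 2 m.*2) -!(expnD 2); congr (2 ^ _)%N; clear; lia.
    have BB : (B.+1 <= 2 ^ m.*2)%N := leq_trans Bp pB.
    by apply: leq_mul; [apply: leq_mul|]; rewrite leq_exp2r // muln_gt0 s0.
  have : (0 < 2 ^ (m.*2 * (11 + 3 * s)))%N by rewrite expn_gt0.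
  by move: q1; lia.
have b0 : (0 < b)%N by rewrite /b /m; lia.
have F0 : (0 < #|F|)%N by rewrite cF prime_gt0.
have [V [prover [VP Vv]]] := scheme_of_machine R (@packK s B F) F0 b0 Symb Qv
  (transcript_sound t0 s0 ts F_inj FB nB) (transcript_complete F t0 s0 ts nB).
exists V, prover, (6 * n * t * b)%N; split=> //.
  (* The constant 200 covers 6 * 18 for the help and, as [l] and [s] are positive, 12 * 14 + 18 + 2
     for the space. *)
  have bl : (b <= 18 * l)%N by rewrite /b /m; lia.
  rewrite -!mulnA [(6 * _)%N]mulnCA.
  have : (n * t * b <= n * t * (18 * l))%N by rewrite leq_mul2l bl orbT.
  rewrite -!mulnA; lia.
rewrite Vv /v /b /m.
have : (l <= s * l)%N by rewrite leq_pmull.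
have : (1 <= s * l)%N by rewrite muln_gt0 s0.
rewrite -mulnA; nia.
Qed.

Theorem theorem4p1 (R : realType) :
  (exists C k : nat, forall n t s : nat, (0 < t)%N -> (0 < s)%N -> (t * s)%N = n ->
     exists (V : verifier R n) (prover : seq {set 'I_n} -> seq bool) (hb : nat),
       is_scheme (@MaxMatching n) V prover hb /\
       (hb <= C * (n * t) * logf n ^ k)%N /\
       (vspace V <= C * s * logf n ^ k)%N)
  /\
  (exists (c : R) (N : nat), 0 < c /\
     forall (n : nat), (N <= n)%N ->
     forall (V : verifier R n) (prover : seq {set 'I_n} -> seq bool) (hb : nat),
       is_scheme (@MaxMatching n) V prover hb ->
       c * (n ^ 2)%:R <= (maxn hb 1 * maxn (vspace V) 1)%:R).
Proof.
split.
  exists 200%N, 1%N => n t s t0 s0 ts.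
  have [V [prover [hb [h1 h2 h3]]]] := matching_scheme R t0 s0 ts.
  by exists V, prover, hb; rewrite expn1.
exists 384^-1, 4%N; split; first by rewrite invr_gt0 ltr0n.
by move=> n n4 V prover hb; apply: scheme_lower_bound.
Qed.
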